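(* Let $n>1$ be an integer. The lattice $\mathcal{L}(\mathbf{Sr}(n,1))$ of all subvarieties of the ai-semiring variety $\mathbf{Sr}(n,1)$ is countable if and only if $n<4$.
   Context: An ai-semiring (additively idempotent semiring) is an algebra $(S,+,\cdot)$ of type $(2,2)$ such that $(S,+)$ is a commutative idempotent semigroup, $(S,\cdot)$ is a semigroup, and the identities $x(y+z)\approx xy+xz$ and $(y+z)x\approx yx+zx$ hold (no zero or unit element is part of the signature). For $n>1$, $\mathbf{Sr}(n,1)$ denotes the variety of all ai-semirings satisfying the identity $x^n\approx x$. The lattice $\mathcal{L}(\mathbf{Sr}(n,1))$ consists of all subvarieties of $\mathbf{Sr}(n,1)$ ordered by inclusion. ''Countable'' means finite or countably infinite. *)

(* Defs.v *)
From mathcomp Require Import all_boot all_classical.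

Set Implicit Arguments.
Unset Strict Implicit.
Unset Printing Implicit Defensive.

Local Open Scope classical_set_scope.

(* Algebras are nonempty, as usual in universal algebra. *)
Record aiSemiring : Type := AiSemiring {
  carrier :> Type;
  add : carrier -> carrier -> carrier;
  mul : carrier -> carrier -> carrier;
  carrier_inhabited : inhabited carrier;
  addA : associative add;
  addC : commutative add;
  addxx : idempotent_op add;
  mulA : associative mul;
  mulDr : right_distributive mul add;
  mulDl : left_distributive mul add
}.

Inductive term : Type :=
  | Var of nat
  | Add of term & term
  | Mul of term & term.

Fixpoint eval (S : aiSemiring) (v : nat -> S) (t : term) : S :=
  match t with
  | Var i => v i
  | Add t1 t2 => add (eval v t1) (eval v t2)
  | Mul t1 t2 => mul (eval v t1) (eval v t2)
  end.

(* The pair (s, t) stands for the identity s ≈ t. *)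
Definition identity : Type := (term * term)%type.

Definition satisfies (S : aiSemiring) (e : identity) : Prop :=
  forall v : nat -> S, eval v e.1 = eval v e.2.

Definition models (E : set identity) : set aiSemiring :=
  [set S | forall e, E e -> satisfies S e].

Definition variety (K : set aiSemiring) : Prop :=
  exists E : set identity, K = models E.

(* For 0 < n, [iterop n Mul x x] is x * (x * ... * x) with n factors. *)
Definition Sr (n : nat) : set aiSemiring :=
  models [set (iterop n Mul (Var 0) (Var 0), Var 0)].

Definition subvarieties (V : set aiSemiring) : set (set aiSemiring) :=
  [set K | variety K /\ K `<=` V].

(* Main.v *)
(** Write the elements of the free algebra as finite sums of words, so that a
variety is determined by the inequalities [w <= sum A] it satisfies.

If x^3 = x, the value of a word depends only on the order of the first
occurrences of its letters, on the order of their last occurrences and on the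
parity of each letter. An inequality [w <= sum A] then holds as soon as it holds
for the valuations taking at most four values: a word with the order of first
occurrences of [w] is built below [sum A] one letter at a time, and at each step
it matters only whether a letter is the new one [x], occurs before [x] in [w],
occurs after [x] in [w], or does not occur in [w]; last occurrences are
symmetric, and a parity vector outside the affine span of those of [A] is
detected by a single linear functional. Over four letters there are finitely many
invariants, so the subvarieties are determined by finite data.

If n > 3, some prime p divides both m = n - 1 and 'C(m, 2), so the flat
extensions of the Heisenberg groups over the fields of order p^d lie in Sr(n, 1).
For primes d an identity recognizes among them the one over the field of order
p^d: it encodes that z^(p^e) = z implies z^p = z, which holds in this field if
and only if d <> e, for primes d and e. Every set of primes thus yields a
different subvariety. *)
From mathcomp Require Import all_boot all_algebra finfield ring all_classical.
Require Import Defs.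

Set Implicit Arguments.
Unset Strict Implicit.
Unset Printing Implicit Defensive.

(** * The word problem for x^3 = x *)

Section WithUnit.
Variable S : aiSemiring.
Implicit Types x y z t u v : option S.

(** [None] is an adjoined unit, the value of the empty word, so that the contexts of a product may
    be empty. *)
Definition omul x y : option S :=
  match x, y with
  | Some a, Some b => Some (mul a b)
  | None, _ => y
  | _, None => x
  end.

Definition ole x y : Prop :=
  match x, y with
  | Some a, Some b => add a b = b
  | None, None => True
  | _, _ => False
  end.

Local Notation "x ** y" := (omul x y) (at level 40, left associativity).
Local Notation "x <== y" := (ole x y) (at level 70).

Lemma omulA : associative omul.
Proof. by move=> [a|] [b|] [c|] //=; rewrite mulA. Qed.

Lemma omulo1 : right_id None omul. Proof. by case. Qed.

Lemma omul1o : left_id None omul. Proof. by []. Qed.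

Lemma isSome_omul x y : (x ** y : bool) = x || y.
Proof. by case: x y => [?|] [?|]. Qed.

Lemma ole_refl x : x <== x.
Proof. by case: x => //= a; rewrite addxx. Qed.

Lemma ole_trans y x z : x <== y -> y <== z -> x <== z.
Proof. by case: x y z => [a|] [b|] [c|] //= ab <-; rewrite addA ab. Qed.

Lemma ole_anti x y : x <== y -> y <== x -> x = y.
Proof. by case: x y => [a|] [b|] //= ab; rewrite addC ab => ->. Qed.

Lemma ole_mul2l z x y : x <== y -> z ** x <== z ** y.
Proof.
by case: x y z => [a|] [b|] [c|] //=; rewrite ?addxx // -mulDr => ->.
Qed.

Lemma ole_mul2r z x y : x <== y -> x ** z <== y ** z.
Proof.
by case: x y z => [a|] [b|] [c|] //=; rewrite ?addxx // -mulDl => ->.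
Qed.

Lemma ole_mul x x' y y' : x <== x' -> y <== y' -> x ** y <== x' ** y'.
Proof. by move=> /(ole_mul2r y) h /(ole_mul2l x')/(ole_trans h). Qed.

Hypothesis cube : forall a : S, mul a (mul a a) = a.

Lemma ocube x : x ** x ** x = x.
Proof. by case: x => //= a; rewrite -mulA cube. Qed.

(* [u ** s ** v] with [s := a + b + c = s ^ 3] dominates [u ** a ** b ** c ** v]. *)
Lemma ole_mul3 u v t x y z : x -> y -> z ->
    u ** x ** v <== t -> u ** y ** v <== t -> u ** z ** v <== t ->
  u ** x ** y ** z ** v <== t.
Proof.
case: x y z => [a|] // [b|] // [c|] // _ _ _ ha hb hc.
pose s := add a (add b c).
have abcs : ole (Some a ** Some b ** Some c) (Some s).
  rewrite -[Some s]ocube; apply: ole_mul; first apply: ole_mul.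
  - by rewrite /= /s !addA addxx.
  - by rewrite /= /s addA [add b a]addC -addA [add b _]addA addxx.
  - by rewrite /= /s addC -!addA addxx.
apply: (@ole_trans (u ** Some s ** v)).
  by rewrite -(omulA u) -(omulA u); apply/ole_mul2r/ole_mul2l.
by case: u v t ha hb hc => [u|] [v|] [t|] //=; rewrite /s ?mulDr ?mulDl ?mulDr
  => ha hb hc; rewrite -!addA hc hb ha.
Qed.

Lemma omul_factor x y z : x ** y ** z = x ** y ** z ** y ** (z ** y ** z).
Proof. by rewrite -!omulA -{1}(ocube (y ** z)) !omulA. Qed.

(** Elements of order at most two in a multiplicative subgroup with identity [e]. *)
Definition invol e x := [/\ e ** x = x, x ** e = x & x ** x = e].

(** The product [y ** x] is a right inverse of [g = x ** y], so [g ** g ** g = g] reduces to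
    [g ** g = e]. *)
Lemma invol_mul e x y : invol e x -> invol e y -> invol e (x ** y).
Proof.
move=> [ex xe xx] [ey ye yy].
have h : (x ** y) ** (y ** x) = e by rewrite omulA -(omulA x) yy xe.
have ge : x ** y ** e = x ** y by rewrite -omulA ye.
split=> //; first by rewrite omulA ex.
move: (x ** y) h ge => g h ge; have : g ** g ** g ** (y ** x) = e by rewrite ocube.
by rewrite -(omulA (g ** g)) h -omulA ge.
Qed.

Lemma invol_comm e x y : invol e x -> invol e y -> x ** y = y ** x.
Proof.
move=> hx hy; have [ex xe xx] := hx; have [ey ye yy] := hy.
have [_ _ h] := invol_mul hx hy.
have : x ** (x ** y ** (x ** y)) ** y = x ** y by rewrite h xe.
by rewrite !omulA xx ey -(omulA _ y) yy -omulA xe => <-.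
Qed.

(** Multiplying [x <== y] by [x] and by [y] puts [x ** y] between the two squares, both equal to
    [e]. *)
Lemma invol_anti e x y : invol e x -> invol e y -> x <== y -> x = y.
Proof.
move=> [ex xe xx] [ey ye yy] xy.
have exy : e = x ** y.
  apply: ole_anti; first by rewrite -xx; apply: ole_mul2l.
  by rewrite -yy; apply: ole_mul2r.
by rewrite -ey -xx -omulA -exy xe.
Qed.

(** Both sides are involutions, so by [invol_anti] it is enough that the right side lies below the
    left one. *)
Lemma invol_insert e s t : e ** e = e -> invol e (e ** s ** e) ->
    invol e (e ** t ** e) -> invol e (e ** s ** t ** e) ->
  e ** s ** t ** e = (e ** s ** e) ** (e ** t ** e).
Proof.
move=> ee hs ht hg.
have [eS|eN] := boolP (e : bool); last first.
  by have -> : e = None; [case: (e) eN | rewrite !omulo1 !omul1o].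
have [_ _ ss] := hs; have [_ _ tt] := ht.
apply/esym/(invol_anti (invol_mul hs ht) hg).
pose a := e ** s ** e; pose b := e ** t ** e; pose g := e ** s ** t ** e.
(* [ab] is the product of [tete], [eses] and [tete] between [es] and [te],
   while each of these three elements between [es] and [te] gives [g]. *)
have {1}-> : a ** b = g ** b ** a ** g.
  have bag := invol_mul ht hs; have [_ ae _] := hs; have [_ _ gg] := hg.
  rewrite -/a -/b in hs ht ae bag *; rewrite -(omulA g) (invol_comm hg bag) -omulA gg.
  by rewrite -omulA ae (invol_comm ht hs).
have tt' x : x ** e ** t ** e ** t ** e = x ** e.
  by rewrite -[in RHS]tt -!omulA (omulA e e) ee.
have ss' x : x ** e ** s ** e ** s ** e = x ** e.
  by rewrite -[in RHS]ss -!omulA (omulA e e) ee.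
have ee' x : x ** e ** e = x ** e by rewrite -omulA ee.
have tt1 : e ** s ** (t ** e ** t ** e) ** (t ** e) = g.
  by rewrite !omulA tt'.
have ss1 : e ** s ** (e ** s ** e ** s) ** (t ** e) = g.
  by have := ss' e; rewrite ee !omulA => ->.
have -> : g ** b ** a ** g = e ** s ** (t ** e ** t ** e) ** (e ** s ** e ** s)
    ** (t ** e ** t ** e) ** (t ** e).
  by rewrite /g /a /b !omulA tt' !ee'.
by apply: ole_mul3; rewrite ?isSome_omul ?eS ?orbT ?tt1 ?ss1 //; apply: ole_refl.
Qed.

End WithUnit.
Arguments omul : simpl never.

(** * Orders of occurrences and parities of letters *)

Section Words.
Variable T : eqType.
Implicit Types (x y : T) (u v w z : seq T).

(** [undup] keeps the last occurrence of each letter; hence the two reversals here, and [undup]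
    itself for last occurrences in [similar]. *)
Definition first_occ w := rev (undup (rev w)).

Definition parity x w := odd (count_mem x w).

Definition similar u v :=
  [/\ undup u = undup v, first_occ u = first_occ v
    & forall x, parity x u = parity x v].

Lemma parity_cat x u v : parity x (u ++ v) = parity x u (+) parity x v.
Proof. by rewrite /parity count_cat oddD. Qed.

Lemma parity_cons x y u : parity x (y :: u) = (y == x) (+) parity x u.
Proof. by rewrite /parity /= oddD oddb. Qed.

Lemma parity_rev x u : parity x (rev u) = parity x u.
Proof. by rewrite /parity count_rev. Qed.

Lemma parity0 x u : x \notin u -> parity x u = false.
Proof. by move/count_memPn; rewrite /parity => ->. Qed.

Lemma mem_first_occ w : first_occ w =i w.
Proof. by move=> x; rewrite mem_rev mem_undup mem_rev. Qed.

Lemma first_occ_cat u v :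
  first_occ (u ++ v) = first_occ u ++ [seq x <- first_occ v | x \notin u].
Proof.
rewrite /first_occ rev_cat undup_cat rev_cat -filter_rev; congr (_ ++ _).
by apply: eq_filter => x; rewrite mem_rev.
Qed.

Lemma filter_notin_nil u v : {subset u <= v} -> [seq x <- u | x \notin v] = [::].
Proof.
move=> uv; apply/eqP; rewrite -(negbK (_ == _)) -has_filter; apply/hasPn => x /uv.
by rewrite negbK.
Qed.

Lemma first_occ_cat_sub u v : {subset v <= u} -> first_occ (u ++ v) = first_occ u.
Proof.
move=> vu; rewrite first_occ_cat filter_notin_nil ?cats0 // => x.
by rewrite mem_first_occ => /vu.
Qed.

Lemma prefix_first_occ_sub u v : prefix (first_occ u) (first_occ v) ->
  {subset u <= v}.
Proof.
move=> /prefixP[s vE] x; rewrite -mem_first_occ -[x \in v]mem_first_occ vE.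
by rewrite mem_cat => ->.
Qed.

Lemma prefix_rcons_first_occ s y w : y \notin s ->
  prefix (rcons s y) (first_occ w) ->
  exists u v, w = u ++ y :: v /\ first_occ u = s.
Proof.
move=> ys /prefixP[r wE].
have yw : y \in w by rewrite -mem_first_occ wE mem_cat mem_rcons mem_head.
exists (take (index y w) w), (drop (index y w).+1 w).
have dE : drop (index y w) w = y :: drop (index y w).+1 w.
  by rewrite (drop_nth y) ?index_mem // nth_index.
have yn : y \notin take (index y w) w.
  apply/negP => h; have := index_mem y (take (index y w) w).
  rewrite h size_take index_mem yw => hi.
  have := index_cat y (take (index y w) w) (drop (index y w) w).
  by rewrite cat_take_drop h => hE; rewrite -hE ltnn in hi.
split; first by rewrite -dE cat_take_drop.
move: wE yn; rewrite -{1}(cat_take_drop (index y w) w) dE first_occ_cat.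
move: (take _ _) (drop _ _) => u v + yn.
rewrite -cat1s first_occ_cat filter_cat /= yn cat_rcons.
rewrite -(mem_first_occ u) in yn.
elim: (first_occ u) s ys yn => [|a t IH] [|b s] //=.
- by rewrite inE => /norP[/eqP yb _] _ [].
- by rewrite inE => _ /norP[/eqP ya _] [/esym/ya].
- rewrite !inE => /norP[_ ys] /norP[_ yt] [-> /(IH _ ys yt) ->] //.
Qed.

Lemma undup_cat_sub u v : {subset u <= v} -> undup (u ++ v) = undup v.
Proof.
move=> uv; rewrite undup_cat filter_notin_nil // => x.
by rewrite mem_undup => /uv.
Qed.

Lemma similar_sym u v : similar u v -> similar v u.
Proof. by case=> h1 h2 h3; split. Qed.

Lemma similar_mem u v : similar u v -> u =i v.
Proof. by case=> h _ _ x; rewrite -mem_undup h mem_undup. Qed.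

Lemma similar_rev u v : similar u v -> similar (rev u) (rev v).
Proof.
case=> h1 h2 h3; split; last by move=> x; rewrite !parity_rev.
  by apply: (can_inj revK); exact: h2.
by rewrite /first_occ !revK h1.
Qed.

End Words.

(** * Values of words under x^3 = x *)

Section Evaluation.
Variables (S : aiSemiring) (T : eqType) (f : T -> S).
Implicit Types (x y : T) (u v w z : seq T).

Definition oprod w : option S := foldr (fun x => omul (Some (f x))) None w.

Lemma oprod0 : oprod [::] = None. Proof. by []. Qed.

Lemma oprod_cons x w : oprod (x :: w) = omul (Some (f x)) (oprod w).
Proof. by []. Qed.

Lemma oprod_cat u v : oprod (u ++ v) = omul (oprod u) (oprod v).
Proof. by elim: u => //= x u ->; rewrite omulA. Qed.

Lemma isSome_oprod w : (oprod w : bool) = (w != [::]).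
Proof. by case: w => //= x w; case: oprod. Qed.

Definition oprodE := (oprod_cat, oprod_cons, oprod0, @omulo1 S).

Hypothesis cube : forall a : S, mul a (mul a a) = a.

Local Notation "x ** y" := (omul x y) (at level 40, left associativity).
Local Notation "x <== y" := (ole x y) (at level 70).

(** If [w = a t b], then [(t b)^3 = t b] allows [t b t b] to be appended to [w]. The rest of [z] is
    absorbed right after the first appended [t], by induction. *)
Lemma oprod_absorb w z : {subset z <= w} ->
  exists z', [/\ {subset z' <= w}, oprod (w ++ z ++ z') = oprod w
               & forall x, parity x (z ++ z') = false].
Proof.
elim: z w => [|t z IH] w zw.
  by exists [::]; rewrite !cats0; split.
have /splitPr wE : t \in w by apply/zw/mem_head.
case: wE zw => a b zw.
have [|z' [z'w z'E z'p]] := IH (a ++ t :: b ++ [:: t]).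
  move=> x xz; have : x \in a ++ t :: b by apply: zw; rewrite in_cons xz orbT.
  by rewrite !(mem_cat, inE); case: (x \in a); case: (x == t); case: (x \in b).
exists (z' ++ b ++ t :: b); split.
- move=> x; rewrite mem_cat => /orP[/z'w|]; rewrite !(mem_cat, inE);
    by case: (x \in a); case: (x == t); case: (x \in b).
- move: z'E; rewrite !oprodE !omulA => ->.
  by rewrite [RHS](omul_factor cube) !omulA.
- move=> x; have := z'p x; rewrite -[t :: z]cat1s -[t :: b]cat1s !parity_cat.
  by do !case: parity.
Qed.

Section Group.
Variable w : seq T.
Local Notation e := (oprod w ** oprod w).
(** Between copies of the idempotent [e], the words over the letters of [w] take values in an
    elementary abelian 2-group, where only parities matter. *)
Definition sandwich u := e ** oprod u ** e.
Local Notation F := sandwich.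

Lemma oprod_idem : e ** e = e.
Proof. by rewrite omulA (ocube cube). Qed.

(** Absorbing [u ++ w ++ w] after [w ++ w] gives [a = F u] a right inverse; then [a ** a ** a = a]
    yields [a ** a = e]. *)
Lemma oprod_invol u : {subset u <= w} -> invol e (F u).
Proof.
move=> uw.
have [|z' [_ zE _]] := @oprod_absorb (w ++ w) (u ++ w ++ w).
  by move=> x; rewrite !mem_cat orbb => /orP[/uw->|->]; rewrite ?orbT.
move: zE oprod_idem; rewrite /sandwich !oprod_cat -(omulA (oprod u)) omulA.
move: (oprod w ** _) => e; rewrite omulA => zE ee.
set a := e ** _ ** e in zE *.
have ae : a ** e = a by rewrite /a -omulA ee.
have ea : e ** a = a by rewrite /a !omulA ee.
by clearbody a; split=> //; rewrite -{2}ae -zE !omulA ocube.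
Qed.

Lemma oprod_sandwich_cat u v : {subset u <= w} -> {subset v <= w} ->
  F (u ++ v) = F u ** F v.
Proof.
move=> uw vw; rewrite /sandwich oprod_cat (omulA e); apply: (invol_insert cube).
- exact: oprod_idem.
- exact: oprod_invol.
- exact: oprod_invol.
- rewrite -(omulA e) -(oprod_cat u); apply: oprod_invol => x.
  by rewrite mem_cat => /orP[/uw|/vw].
Qed.

Lemma oprod_sandwich_even u : {subset u <= w} -> (forall x, parity x u = false) ->
  F u = e.
Proof.
have [n] := ubnP (size u); elim: n u => // n IH [|t u] un uw up.
  by rewrite /sandwich oprod0 omulo1 oprod_idem.
have /splitPr uE : t \in u.
  have := up t; rewrite -cat1s parity_cat; apply: contraFT => /parity0->.
  by rewrite /parity /= eqxx.
case: uE un uw up => a b un uw up.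
have aw : {subset a <= w} by move=> x xa; apply: uw; rewrite !(mem_cat, inE) xa orbT.
have bw : {subset b <= w} by move=> x xa; apply: uw; rewrite !(mem_cat, inE) xa !orbT.
have tw : {subset [:: t] <= w}.
  by move=> x; rewrite inE => /eqP->; apply: uw; rewrite inE eqxx.
have abw : {subset a ++ b <= w} by move=> x; rewrite mem_cat => /orP[/aw|/bw].
have tbw : {subset t :: b <= w}.
  by move=> x; rewrite inE => /orP[/eqP->|/bw//]; apply: tw; rewrite inE.
have atbw : {subset a ++ t :: b <= w} by move=> x; rewrite mem_cat => /orP[/aw|/tbw].
rewrite -cat1s oprod_sandwich_cat // oprod_sandwich_cat //.
rewrite -(cat1s t b) oprod_sandwich_cat //.
have ta := invol_comm cube (oprod_invol tw) (oprod_invol aw).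
have [_ _ tt] := oprod_invol tw; have [ea _ _] := oprod_invol aw.
rewrite (omulA (F [:: t]) (F a)) ta -(omulA (F a)) (omulA (F [:: t]) (F [:: t])) tt.
have [eb _ _] := oprod_invol bw.
rewrite eb -oprod_sandwich_cat //; apply: IH => //.
  by move: un; rewrite /= !size_cat /= addnS !ltnS => /ltnW.
move=> x; have := up x; rewrite -cat1s -(cat1s t b) !parity_cat.
by do !case: parity.
Qed.

Lemma oprod_sandwich_parity u v : {subset u <= w} -> {subset v <= w} ->
  (forall x, parity x u = parity x v) -> F u = F v.
Proof.
move=> uw vw uv.
have uvw : {subset u ++ v <= w} by move=> x; rewrite mem_cat => /orP[/uw|/vw].
have : F (u ++ v) = e.
  by apply: oprod_sandwich_even => // x; rewrite parity_cat uv addbb.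
have [_ ue uu] := oprod_invol uw; have [ve _ vv] := oprod_invol vw.
by rewrite oprod_sandwich_cat // => uve; rewrite -ue -vv omulA uve.
Qed.

End Group.

(** Induction on [g]. A letter already in [g] is absorbed; a new letter [y] is the next first
    occurrence of [w = p ++ y :: r], where [p] has the letters of [g]. *)
Lemma oprod_prefix w g : w != [::] -> prefix (first_occ g) (first_occ w) ->
  exists h, [/\ h != [::], {subset h <= w}, oprod (g ++ h) <== oprod w
              & forall x, parity x (g ++ h) = parity x w].
Proof.
move=> w0; elim/last_ind: g => [_|g y IH].
  by exists w; split=> //; exact: ole_refl.
rewrite -cats1 first_occ_cat /= => gyw.
have gw : prefix (first_occ g) (first_occ w).
  exact: prefix_trans (prefix_prefix _ _) gyw.
have gsub := prefix_first_occ_sub gw.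
have [h [h0 hw hle hp]] := IH gw.
have [yg|yg] := boolP (y \in g).
  have [|z [zg zE zp]] := @oprod_absorb g [:: y].
    by move=> x; rewrite inE => /eqP->.
  exists (z ++ h); split.
  - by case: (z).
  - by move=> x; rewrite mem_cat => /orP[/zg/gsub|/hw].
  - by rewrite -catA !catA oprod_cat -catA zE -oprod_cat.
  - move=> x; rewrite -hp; have := zp x; rewrite !parity_cat.
    by do !case: parity.
move: gyw; rewrite yg cats1 => /prefix_rcons_first_occ[].
  by rewrite mem_first_occ.
move=> p [r [wE pg]].
have pgi : p =i g by move=> x; rewrite -mem_first_occ pg mem_first_occ.
have w3 : oprod (w ++ w ++ w) = oprod w by rewrite !oprodE omulA ocube.
have [g0|gN0] := eqVneq g [::].
  have p0 : p = [::].
    by case: (p) pgi => // a q /(_ a); rewrite mem_head g0.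
  have E : (g ++ [:: y]) ++ r ++ w ++ w = w ++ w ++ w.
    have yr : y :: r = w by rewrite wE p0.
    by rewrite g0 /= -cat_cons yr.
  exists (r ++ w ++ w); split.
  - by case: (w) w0 => // a q _; case: (r).
  - by move=> x; rewrite !mem_cat orbb => /orP[xr|//]; rewrite wE mem_cat inE xr !orbT.
  - by rewrite E w3; apply: ole_refl.
  - by move=> x; rewrite E !parity_cat addbb addbF.
(* As [g] and [p] have the same letters, there are [z] and [z'] such that [g p z] has the value of
   [g] and [p z z'] that of [p]. The added copies of [g] make [z] nonempty, as [ole_mul3]
   requires. *)
have [|z0 [zg zE zp]] := @oprod_absorb g p; first by move=> x; rewrite pgi.
pose z := z0 ++ g ++ g.
have {}zg : {subset z <= g}.
  by move=> x; rewrite !mem_cat orbb => /orP[/zg|].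
have {}zE : oprod (g ++ p ++ z) = oprod g.
  by rewrite /z !catA -(catA g) !(oprod_cat _ g) zE ocube.
have {}zp x : parity x (p ++ z) = false.
  have := zp x; rewrite /z !parity_cat; by do !case: parity.
have z1 : z != [::] by rewrite /z; case: (g) gN0 => // ? ?; case: (z0).
clearbody z; have [|z' [z'p z'E z'q]] := @oprod_absorb p z.
  by move=> x /zg; rewrite pgi.
have [q qE] : exists q, q = y :: r by exists (y :: r).
have q0 : q != [::] by rewrite qE.
rewrite -qE in wE.
(* [w1] moves [z] in front of the first [y] of [w], and prefixing it with [g]
   turns the initial factor [g p z] into [g]; both steps use [ole_mul3]. *)
pose w1 := p ++ z ++ (q ++ w ++ p ++ z) ++ z ++ (z' ++ q).
have pzw : oprod p ** oprod z ** oprod (z' ++ q) = oprod w.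
  by rewrite wE !oprod_cat omulA -[in RHS]z'E !oprod_cat !omulA.
have w1w : oprod w1 <== oprod w.
  rewrite /w1 !(oprod_cat p, oprod_cat z, oprod_cat (q ++ _)) !omulA.
  apply: (ole_mul3 cube); rewrite ?isSome_oprod ?pzw //; try exact: ole_refl.
    by case: (q) q0.
  have -> : oprod p ** oprod (q ++ w ++ p ++ z) ** oprod (z' ++ q) =
      oprod p ** oprod q ** oprod w ** (oprod p ** oprod z ** oprod (z' ++ q)).
    by rewrite (oprod_cat q) (oprod_cat w) (oprod_cat p) !omulA.
  by rewrite pzw -(oprod_cat p) -wE ocube //; apply: ole_refl.
pose h' := (r ++ w ++ p ++ z) ++ z ++ (z' ++ q) ++ w ++ g ++ g ++ h.
have h'E : (g ++ [:: y]) ++ h' =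
    g ++ (q ++ w ++ p ++ z) ++ z ++ (z' ++ q) ++ w ++ g ++ g ++ h.
  by rewrite -catA /h' qE.
have E : oprod ((g ++ [:: y]) ++ h') = oprod (g ++ (w1 ++ w ++ g) ++ g ++ h).
  rewrite h'E oprod_cat -{1}zE -oprod_cat /w1; congr oprod.
  by rewrite -!catA.
have wq : {subset q <= w} by move=> x xq; rewrite wE mem_cat xq orbT.
have wp : {subset p <= w} by move=> x xq; rewrite wE mem_cat xq.
exists h'; split.
- by rewrite /h'; case: (h) h0 => // a b _; rewrite -!size_eq0 !size_cat /= !addnS.
- have rq : {subset r <= q} by move=> x xr; rewrite qE inE xr orbT.
  move=> x; rewrite !mem_cat -!orbA.
  by do !(case/orP); move=> // ?; do ?[exact: hw | exact: wp | exact/wq/rq |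
    exact/wq | exact/gsub/zg | exact/gsub | exact/wp/z'p].
- have -> : oprod ((g ++ [:: y]) ++ h') =
      None ** oprod g ** oprod (w1 ++ w ++ g) ** oprod g ** oprod h.
    by rewrite E omul1o !oprod_cat !omulA.
  have gh : oprod g ** oprod h <== oprod w by rewrite -oprod_cat.
  apply: (ole_mul3 cube); rewrite ?isSome_oprod //.
    by case: (w1) => // ; case: (w) w0.
  rewrite omul1o -[X in _ <== X]w3 !(oprod_cat w) oprod_cat.
  rewrite oprod_cat -!(omulA (oprod w1)) -(omulA (oprod w)).
  by apply: ole_mul => //; apply: ole_mul => //; apply: ole_refl.
- move=> x; rewrite h'E -hp; have := z'q x; have := zp x.
  have : parity x w = parity x (p ++ q) by rewrite -wE.
  have := hp x; rewrite !parity_cat.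
  by do !case: parity.
Qed.

End Evaluation.

(** Exchanges prefixes and suffixes, so that [oprod_prefix] also yields [oprod_suffix]. *)
Definition opposite (S : aiSemiring) : aiSemiring :=
  @AiSemiring S (@add S) (fun x y => mul y x) (carrier_inhabited S)
    (@addA S) (@addC S) (@addxx S) (fun x y z => esym (mulA z y x))
    (fun x y z => mulDl y z x) (fun x y z => mulDr z x y).

Lemma oprod_opposite (S : aiSemiring) (T : eqType) (f : T -> S) (w : seq T) :
  @oprod (opposite S) T f w = oprod f (rev w).
Proof.
elim: w => //= x w IH; rewrite rev_cons -cats1 oprod_cat oprod_cons IH.
by case: (oprod f (rev w)).
Qed.

Section WordProblem.
Variables (S : aiSemiring) (T : eqType) (f : T -> S).
Hypothesis cube : forall a : S, mul a (mul a a) = a.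
Implicit Types u v w : seq T.
Local Notation "x ** y" := (omul x y) (at level 40, left associativity).
Local Notation "x <== y" := (ole x y) (at level 70).

Lemma oprod_suffix w g : w != [::] ->
    prefix (first_occ (rev g)) (first_occ (rev w)) ->
  exists h, [/\ h != [::], {subset h <= w}, oprod f (h ++ g) <== oprod f w
              & forall x, parity x (h ++ g) = parity x w].
Proof.
move=> w0 gw; have [||h [h0 hw hle hp]] := @oprod_prefix (opposite S) T f _ _ _ _ gw.
- by move=> a; exact: etrans (esym (@mulA S a a a)) (cube a).
- by rewrite -size_eq0 size_rev size_eq0.
exists (rev h); split.
- by rewrite -size_eq0 size_rev size_eq0.
- by move=> x; rewrite mem_rev => /hw; rewrite mem_rev.
- by move: hle; rewrite !oprod_opposite rev_cat !revK.
- by move=> x; have := hp x; rewrite !parity_cat !parity_rev addbC.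
Qed.

(** With [w' h] and [k w'] below [w], the word [w' h w k w'] lies below [w^3 = w]. Its value is that
    of [w'], because [h w k] has the parities of [w'] and stands between copies of [w' = w'^3]. *)
Lemma oprod_similar u v : similar u v -> oprod f u = oprod f v.
Proof.
suff le w w' : similar w w' -> oprod f w' <== oprod f w.
  by move=> uv; apply: ole_anti; apply: le => //; apply: similar_sym.
move=> ww'; have [w0|w0] := eqVneq w [::].
  have -> : w' = w.
    by case: (w') (similar_mem ww') => // a s /(_ a); rewrite w0 mem_head.
  exact: ole_refl.
have [wu wi wp] := ww'; have wm := similar_mem ww'.
have [|h [h0 hw hle hp]] := @oprod_prefix S T f cube w w' w0.
  by rewrite wi prefix_refl.
have [|k [k0 kw kle kp]] := @oprod_suffix w w' w0.
  by rewrite /first_occ !revK wu prefix_refl.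
have XE : sandwich f w' (h ++ w ++ k) = sandwich f w' w'.
  apply: oprod_sandwich_parity => // x.
    by rewrite -wm !mem_cat => /or3P[/hw|//|/kw].
  have := kp x; have := hp x; rewrite !parity_cat -wp; by do !case: parity.
have w3 x : x ** oprod f w' ** oprod f w' ** oprod f w' = x ** oprod f w'.
  by rewrite -!omulA (omulA (oprod f w')) ocube.
have E : oprod f ((w' ++ h) ++ w ++ (k ++ w')) = oprod f w'.
  have -> : oprod f ((w' ++ h) ++ w ++ k ++ w') =
     oprod f w' ** sandwich f w' (h ++ w ++ k) ** oprod f w'.
    by rewrite /sandwich !oprod_cat !omulA ocube // !w3.
  by rewrite XE /sandwich !omulA ocube // !w3 ocube.
rewrite -[X in X <== _]E -[X in _ <== X](ocube cube) !(oprod_cat f (_ ++ _)).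
rewrite (oprod_cat f w) omulA.
by apply: ole_mul => //; apply: ole_mul => //; apply: ole_refl.
Qed.

End WordProblem.

(** * Closed sets of words *)

Section ClosedSets.
Variable T : eqType.
Implicit Types (x y : T) (a b c g h u v w : seq T) (D : seq T -> Prop).

(** What is retained of the set of words below a fixed element: the word problem and [ole_mul3]. *)
Definition closed D :=
  [/\ forall w, D w -> w != [::],
      forall u v, similar u v -> D u -> D v
    & forall u v a b c, a != [::] -> b != [::] -> c != [::] ->
        D (u ++ a ++ v) -> D (u ++ b ++ v) -> D (u ++ c ++ v) ->
        D (u ++ a ++ b ++ c ++ v)].

Lemma closed_ole (S : aiSemiring) (f : T -> S) t :
  (forall a : S, mul a (mul a a) = a) ->
  closed (fun w => ole (oprod f w) (Some t)).
Proof.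
move=> cube; split.
- by move=> w; rewrite -(isSome_oprod f); case: oprod.
- by move=> u v /(oprod_similar f cube) ->.
- move=> u v a b c a0 b0 c0; rewrite !oprod_cat !omulA.
  by apply: ole_mul3; rewrite ?isSome_oprod.
Qed.

Lemma closed_rev D : closed D -> closed (fun w => D (rev w)).
Proof.
have rev0 w : (rev w != [::]) = (w != [::]) by rewrite -!size_eq0 size_rev.
case=> D0 Dsim D3; split.
- by move=> w /D0; rewrite rev0.
- by move=> u v /similar_rev; apply: Dsim.
- move=> u v a b c a0 b0 c0; rewrite !rev_cat -!catA => ha hb hc.
  by apply: D3; rewrite ?rev0.
Qed.

Lemma closed_and D E : closed D -> closed E -> closed (fun w => D w /\ E w).
Proof.
move=> [D0 Dsim D3] [E0 Esim E3]; split.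
- by move=> w [/D0].
- by move=> u v uv [/(Dsim _ _ uv) ? /(Esim _ _ uv)].
- move=> u v a b c a0 b0 c0 [? ?] [? ?] [? ?]; split; first exact: D3.
  exact: E3.
Qed.

Lemma similar_sandwich u b v : {subset b <= u} -> {subset b <= v} ->
  (forall x, parity x b = false) -> similar (u ++ v) (u ++ b ++ v).
Proof.
move=> bu bv bp; split.
- by rewrite !(undup_cat u) undup_cat_sub //; congr (_ ++ _); apply: eq_filter => x;
    rewrite mem_cat; case xb: (x \in b) => //; rewrite bv.
- rewrite catA !(first_occ_cat _ v) first_occ_cat_sub //; congr (_ ++ _).
  by apply: eq_filter => x; rewrite mem_cat; case xb: (x \in b); rewrite ?orbF // bu.
- by move=> x; rewrite !parity_cat bp.
Qed.

Lemma first_occ_cat_prefix u v : prefix (first_occ u) (first_occ v) ->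
  first_occ (u ++ v) = first_occ v.
Proof.
move=> /prefixP[s vE]; rewrite first_occ_cat vE filter_cat.
have : uniq (first_occ v) by rewrite rev_uniq undup_uniq.
rewrite vE cat_uniq => /and3P[_ /hasPn su _].
rewrite filter_notin_nil; last by move=> x; rewrite mem_first_occ.
by congr (_ ++ _); apply/all_filterP/allP => x /su; rewrite mem_first_occ.
Qed.

Lemma prefix_first_occ_cat u x v : x \notin u ->
  prefix (rcons (first_occ u) x) (first_occ (u ++ x :: v)).
Proof.
move=> xu; rewrite first_occ_cat -cat1s first_occ_cat filter_cat /= xu.
by rewrite catA cats1 prefix_prefix.
Qed.

Lemma first_occ_uniq u : uniq u -> first_occ u = u.
Proof. by move=> uu; rewrite /first_occ undup_id ?revK // rev_uniq. Qed.

Lemma prefix_first_occ_split s w : prefix s (first_occ w) ->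
  exists g h, w = g ++ h /\ first_occ g = s.
Proof.
case/lastP: s => [_|s y sw]; first by exists [::], w.
have ys : y \notin s.
  have /prefixP[t wE] := sw; have : uniq (first_occ w) by rewrite rev_uniq undup_uniq.
  by rewrite wE cat_uniq rcons_uniq => /and3P[/andP[]].
have [u [v [wE us]]] := prefix_rcons_first_occ ys sw.
exists (u ++ [:: y]), v; rewrite -catA; split=> //.
by rewrite first_occ_cat us /= -mem_first_occ us ys cats1.
Qed.

Section Closed.
Variable D : seq T -> Prop.
Hypothesis cD : closed D.

Lemma closed_neq0 w : D w -> w != [::]. Proof. by case: cD => D0 _ _ /D0. Qed.

Lemma closed_sim u v : similar u v -> D u -> D v.
Proof. by case: cD => _ Dsim _; apply: Dsim. Qed.

Lemma closed3 a b c : D a -> D b -> D c -> D (a ++ b ++ c).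
Proof.
case: cD => D0 _ D3 Da Db Dc; rewrite -[c]cats0.
by apply: (D3 [::] [::]); rewrite ?cats0 ?D0.
Qed.

(* Any even product from [D] can be inserted after a prefix of a word of [D];
   the copies of the prefix that follow do not change the first occurrences. *)
Lemma closed_graft a b g h : D (g ++ h) -> D a -> D b ->
  D (g ++ (a ++ b) ++ g ++ g ++ h).
Proof.
move=> + Da Db; have [->|g0] := eqVneq g [::] => Dgh.
  by rewrite /= -catA; apply: closed3.
have [D0 _ D3] := cD.
rewrite (_ : _ ++ _ = [::] ++ g ++ (a ++ b ++ g) ++ g ++ h); last by rewrite -!catA.
apply: D3 => //.
- by case: (a) (D0 _ Da).
- by rewrite /= -!catA; apply: closed3.
Qed.

Lemma closed_content (A : seq (seq T)) : A != [::] -> (forall a, a \in A -> D a) ->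
  exists2 p, D p & p =i flatten A.
Proof.
elim: A => // a A IH _ DA; have Da : D a by apply: DA; rewrite mem_head.
have [A0|A0] := eqVneq A [::]; first by exists a; rewrite // A0 /= cats0.
have [//|b bA|p Dp pA] := IH; first by apply: DA; rewrite inE bA orbT.
by exists (a ++ p ++ p); [exact: closed3 | move=> x; rewrite !mem_cat orbb pA].
Qed.

(** [closed3] multiplies three members, so each prepended block consists of two; hence the squares
    among the values of the substitutions below. *)
Lemma closed_flatten (B : seq (seq T)) w : D w ->
  (forall b, b \in B -> exists c d, [/\ D c, D d & b = c ++ d]) ->
  D (flatten B ++ w).
Proof.
move=> Dw; elim: B => //= b B IH DB.
have [c [d [Dc Dd ->]]] := DB b (mem_head _ _).
rewrite -!catA; apply: closed3 => //; apply: IH => e eB.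
by apply: DB; rewrite inE eB orbT.
Qed.

Lemma closed_insert p v B u : D p -> D v -> D (u ++ v) ->
  (forall b, b \in B ->
    [\/ [/\ {subset b <= u}, {subset b <= v} & forall x, parity x b = false],
        b = v ++ v | b = v ++ p ++ v ++ p]) ->
  D (u ++ flatten B ++ v).
Proof.
move=> Dp Dv; elim: B u => //= b B IH u Duv DB.
rewrite -catA catA; apply: IH.
  have [[bu bv bp]|->|->] := DB b (mem_head _ _).
  - by rewrite -catA; apply: closed_sim Duv; apply: similar_sandwich.
  - by rewrite -!catA (catA u); apply: closed3.
  - rewrite -!catA (catA u); apply: closed3 => //; exact: closed3.
move=> c cB; have [|[cu cv cp]|->|->] := DB c; first by rewrite inE cB orbT.
- by constructor 1; split=> // x /cu; rewrite mem_cat => ->.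
- by constructor 2.
- by constructor 3.
Qed.

End Closed.

Definition subst (s : T -> seq T) w := flatten (map s w).

Lemma subst_cat s u v : subst s (u ++ v) = subst s u ++ subst s v.
Proof. by rewrite /subst map_cat flatten_cat. Qed.

Lemma subst_cons s x u : subst s (x :: u) = s x ++ subst s u.
Proof. by []. Qed.

Lemma mem_subst s y x w : y \in w -> x \in s y -> x \in subst s w.
Proof. by move=> yw xy; apply/flatten_mapP; exists y. Qed.

Lemma subst_sub s w u : (forall y, y \in w -> {subset s y <= u}) ->
  {subset subst s w <= u}.
Proof. by move=> su x /flatten_mapP[y yw]; apply: su. Qed.

Lemma parity_subst s w x : (forall y, y \in w -> parity x (s y) = false) ->
  parity x (subst s w) = false.
Proof.
elim: w => // y w IH sw; rewrite subst_cons parity_cat sw ?mem_head //= IH // => z zw.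
by apply: sw; rewrite inE zw orbT.
Qed.

Lemma rev_subst s w : rev (subst s w) = subst (rev \o s) (rev w).
Proof.
elim: w => // x w IH; rewrite subst_cons rev_cat IH rev_cons -cats1 subst_cat.
by rewrite /subst /= cats0.
Qed.

End ClosedSets.

(** * Transfer from four values *)

Section Transfer.
Variable T : eqType.
Implicit Types (x y : T) (a b c g h u v w : seq T).

(* A deduction step of the equational logic with [w <= sum A]: substitutions
   taking at most four values are applied to it, inside a context. *)
Definition substitutive (A : seq (seq T)) (C H : seq T -> Prop) :=
  forall (s : T -> seq T) (vals : seq (seq T)) l u r,
    size vals <= 4 -> (forall x, s x \in vals) -> (forall x, s x != [::]) ->
    H u -> (forall a, a \in A -> C (l ++ subst s a ++ r)) ->
    C (l ++ subst s u ++ r).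

(* [C] is meant to be the set of words below the sum of [A] in a given algebra,
   and [H] the set of words that are so for all four-valued valuations. *)
Record transfer (A : seq (seq T)) (C H : seq T -> Prop) : Prop := Transfer {
  transfer_C : closed C;
  transfer_H : closed H;
  transfer_CH : forall w, C w -> H w;
  transfer_AC : forall a, a \in A -> C a;
  transfer_subst : substitutive A C H
}.

(* If [A] has a letter outside [u], then the words that contain all the letters
   of [A] have already been transferred. *)
Definition full (A : seq (seq T)) (C H : seq T -> Prop) u :=
  forall a w, a \in A -> ~~ all (mem u) a ->
    H w -> (forall b, b \in A -> {subset b <= w}) -> C w.

Lemma transfer_rev A C H : transfer A C H ->
  transfer (map rev A) (fun w => C (rev w)) (fun w => H (rev w)).
Proof.
move=> [cC cH CH AC sub]; split.
- exact: closed_rev.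
- exact: closed_rev.
- by move=> w; apply: CH.
- by move=> _ /mapP[a aA ->]; rewrite revK; apply: AC.
- move=> s vals l u r sz sv s0 Hu Cu; rewrite !rev_cat -catA rev_subst.
  apply: (sub _ (map rev vals)) => //.
  + by rewrite size_map.
  + by move=> x; apply: map_f.
  + by move=> x; rewrite /= -size_eq0 size_rev size_eq0.
  + move=> a aA; rewrite -[a]revK -rev_subst catA -!rev_cat.
    by apply: Cu; apply: map_f.
Qed.

Lemma full_rev A C H u : full A C H u ->
  full (map rev A) (fun w => C (rev w)) (fun w => H (rev w)) (rev u).
Proof.
move=> fu _ w /mapP[a aA ->] au Hw Aw; apply: (fu a) => //.
  apply: contra au => /allP au; apply/allP => x; rewrite mem_rev => /au.
  by rewrite /= mem_rev.
move=> b bA x xb; rewrite mem_rev; apply: (Aw (rev b)); last by rewrite mem_rev.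
exact: map_f.
Qed.

(** * Transfer of the letters and of the order of first occurrences *)

Section Main.
Variables (A : seq (seq T)) (C H : seq T -> Prop).
Hypothesis tr : transfer A C H.
Hypothesis A0 : A != [::].
Let cC := transfer_C tr.
Let cH := transfer_H tr.
Let CH := transfer_CH tr.
Let AC := transfer_AC tr.

Variable u : seq T.
Hypothesis Hu : H u.
Hypothesis fu : full A C H u.

Lemma total_word : exists2 p, C p & forall a, a \in A -> {subset a <= p}.
Proof.
have [p Cp pA] := closed_content cC A0 AC.
by exists p => // a aA x xa; rewrite pA; apply/flattenP; exists a.
Qed.

(** Letters of [u] are sent to [u ++ u], the others to [p ++ p]. The image of each word of [A] then
    has all the letters of [A], so [full] applies, while the image of [u], put before [u], gives a
    word similar to [u]. *)
Lemma transfer_disjoint : ~~ has (all (mem u)) A -> C u.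
Proof.
move=> /hasPn Au; have [p Cp pA] := total_word.
have u0 := closed_neq0 cH Hu; have p0 := closed_neq0 cC Cp.
pose s x := if x \in u then u ++ u else p ++ p.
have : C ([::] ++ subst s u ++ u).
  apply: (@transfer_subst _ _ _ tr s [:: u ++ u; p ++ p]) => //.
  - by move=> x; rewrite /s !inE; case: ifP; rewrite eqxx ?orbT.
  - by move=> x; rewrite /s; case: ifP => _; [case: (u) u0 | case: (p) p0].
  move=> a aA; have [x xa xu0] := allPn (Au a aA); have xu : x \notin u := xu0.
  apply: (fu aA (Au a aA)) => /=.
    apply: closed_flatten => // _ /mapP[y _ ->].
    by rewrite /s; case: ifP => _; [exists u, u | exists p, p; split=> //; apply: CH].
  move=> b bA y yb; rewrite mem_cat (mem_subst xa) // /s (negPf xu) mem_cat.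
  by rewrite (pA b).
have su y : y \in u -> s y = u ++ u by rewrite /s => ->.
have sub : {subset subst s u <= u}.
  by apply: subst_sub => y /su-> x; rewrite mem_cat orbb.
apply: (closed_sim cC) => /=.
split; first by rewrite undup_cat_sub.
- have sE : subst s u = u ++ u ++ subst s (behead u).
    by case: (u) u0 su => // x w _ su; rewrite subst_cons su ?mem_head -?catA.
  by move: sub; rewrite sE -catA => sub; rewrite first_occ_cat_sub // => x;
    rewrite mem_cat => /orP[xu|//]; apply: sub; rewrite mem_cat xu orbT.
- move=> x; rewrite parity_cat parity_subst // => y /su->.
  by rewrite parity_cat addbb.
Qed.

Hypothesis Au : has (all (mem u)) A.

(** Let [q] have the letters of the words of [A] over [u]. If it misses a letter of [u], letters are
    sent to squares of [q], [u] or [p]: words of [A] over [u] become products of copies of [q], and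
    the missed letter brings all of [u] into the image of [u]. *)
Lemma transfer_content : exists2 v, C v & v =i u.
Proof.
pose B := [seq a <- A | all (mem u) a].
have BA a : a \in B -> a \in A by rewrite mem_filter => /andP[].
have B0 : B != [::] by rewrite -has_filter.
have [q Cq qB] := closed_content cC B0 (fun a aB => AC (BA a aB)).
have qu : {subset q <= u}.
  by move=> x; rewrite qB => /flattenP[a]; rewrite mem_filter => /andP[/allP au _ /au].
have [uq|] := boolP (all (mem q) u).
  exists q => // x; apply/idP/idP => [/qu//|]; exact: (allP uq).
move=> /allPn[z zu zq]; have [p Cp pA] := total_word.
have u0 := closed_neq0 cH Hu; have p0 := closed_neq0 cC Cp; have q0 := closed_neq0 cC Cq.
pose s x := if x \in q then q ++ q else if x \in u then u ++ u else p ++ p.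
have sH x : exists c d, [/\ H c, H d & s x = c ++ d].
  rewrite /s; case: ifP => _; last case: ifP => _.
  - by exists q, q; split=> //; apply: CH.
  - by exists u, u.
  - by exists p, p; split=> //; apply: CH.
have := @transfer_subst _ _ _ tr s [:: q ++ q; u ++ u; p ++ p] [::] u q.
move=> /= C1; exists (subst s u ++ q); last first.
  move=> x; rewrite mem_cat; apply/idP/idP => [/orP[|/qu//]|xu].
    apply: subst_sub => y yu w; rewrite /s yu.
    by case: ifP => _; rewrite mem_cat orbb // => /qu.
  rewrite (mem_subst zu) // /s zu; move: zq => /= /negPf; rewrite -/(z \in q) => ->.
  by rewrite mem_cat xu.
apply: C1 => //.
- by move=> x; rewrite /s !inE; do 2?[case: ifP => _]; rewrite eqxx ?orbT.
- move=> x; rewrite /s; case: ifP => _; last case: ifP => _;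
  by [case: (q) q0 | case: (u) u0 | case: (p) p0].
move=> a aA; have [au|au] := boolP (all (mem u) a).
  apply: closed_flatten => // _ /mapP[y ya ->]; exists q, q; split=> //.
  by rewrite /s qB ifT //; apply/flattenP; exists a; rewrite // mem_filter au.
apply: (fu aA au).
  by apply: closed_flatten; [| exact: CH | move=> _ /mapP[y _ ->]; exact: sH].
have [x xa xu0] := allPn au; have xu : x \notin u := xu0.
move=> b bA y yb; rewrite mem_cat (mem_subst xa) // /s (negPf xu) ifF ?mem_cat ?(pA b) //.
by apply: contraNF xu => /qu.
Qed.

Lemma split_notin (s a : seq T) : all (mem s) a \/
  exists b y c, [/\ a = b ++ y :: c, all (mem s) b & y \notin s].
Proof.
elim: a => [|x a [IH|[b [y [c [-> bs ys]]]]]]; first by left.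
- have [xs|xs] := boolP (x \in s); first by left; rewrite /= xs.
  by right; exists [::], x, a.
- have [xs|xs] := boolP (x \in s); last by right; exists [::], x, (b ++ y :: c).
  by right; exists (x :: b), y, c; rewrite /= xs.
Qed.

(** If some word of [A] over the letters of [u] has [x] as its first letter outside [s], it is
    grafted into [v] after a prefix with first occurrences [s]. Otherwise a substitution gives [u]
    the required start and turns such words of [A] into words similar to [v]. *)
Lemma transfer_first_occ_step s x v : prefix (rcons s x) (first_occ u) ->
  C v -> v =i u -> prefix s (first_occ v) ->
  exists w, [/\ C w, w =i u & prefix (rcons s x) (first_occ w)].
Proof.
move=> sxu Cv vu sv; have Hv := CH Cv.
have us : uniq (rcons s x).
  have /prefixP[t uE] := sxu; have : uniq (first_occ u) by rewrite rev_uniq undup_uniq.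
  by rewrite uE cat_uniq => /and3P[].
move: us; rewrite rcons_uniq => /andP[xs us].
have [u1 [u2 [uE u1s]]] := prefix_rcons_first_occ xs sxu.
have u1i : u1 =i s by move=> y; rewrite -mem_first_occ u1s.
have [g [h [vE gs]]] := prefix_first_occ_split sv.
have gi : g =i s by move=> y; rewrite -mem_first_occ gs.
have xu : x \in u by rewrite uE mem_cat inE eqxx orbT.
have su y : y \in s -> y \in u by rewrite -u1i uE mem_cat => ->.
have vv w : {subset w <= u} -> {subset w <= v} by move=> wu y /wu; rewrite vu.
pose starts a := all (mem u) a && (ohead [seq y <- a | y \notin s] == Some x).
have [/hasP[a aA /andP[au0 ax]]|/hasPn nostart] := boolP (has starts A).
  have au : {subset a <= u} by apply/allP.
  have [a_s|[a1 [y [a2 [aE a1s ys]]]]] := split_notin s a.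
    by move: ax; rewrite filter_notin_nil // => z /(allP a_s).
  have yx : y = x.
    move: ax; rewrite aE filter_cat filter_notin_nil /= ?ys; first by case/eqP.
    by move=> z /(allP a1s).
  rewrite {y}yx in aE ys; exists (g ++ (a ++ v) ++ g ++ g ++ h); split.
  - by apply: closed_graft => //; [rewrite -vE | exact: AC].
  - have gh y : (y \in v) = (y \in g) || (y \in h) by rewrite vE mem_cat.
    move=> y; rewrite !mem_cat -vu gh; case: (boolP (y \in a)) => [/au|_].
      by rewrite -vu gh => ->; case: (y \in g).
    by do 2!case: (_ \in _).
  - have ga1 : first_occ (g ++ a1) = s.
      by rewrite first_occ_cat_sub ?gs // => z /(allP a1s); rewrite gi.
    rewrite aE -!catA catA -{1}ga1 /=; apply: prefix_first_occ_cat.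
    by rewrite -mem_first_occ ga1.
(* Letters that occur in [u] before [x], [x] itself, the other letters of [u]
   and the letters outside [u] receive the four values. *)
have [p Cp pA] := total_word.
pose t y := if y \in s then s ++ s else if y == x then [:: x; x]
  else if y \in u then v ++ v else v ++ p ++ v ++ p.
have v0 := closed_neq0 cC Cv.
pose W := (s ++ s) ++ subst t u1.
exists ((s ++ s) ++ subst t u ++ v).
have Wsub a : all (mem s) a -> {subset (s ++ s) ++ subst t a <= s}.
  move=> /allP a_s z; rewrite mem_cat mem_cat orbb => /orP[//|].
  by apply: subst_sub => y /a_s /= ys w; rewrite /t ys mem_cat orbb.
have Wfirst a : all (mem s) a -> first_occ ((s ++ s) ++ subst t a) = s.
  move=> /Wsub a_s; rewrite -catA first_occ_cat_sub ?first_occ_uniq // => z zz.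
  by apply: a_s; rewrite -catA mem_cat zz orbT.
have tu a : all (mem u) a -> {subset subst t a <= v}.
  move=> /allP au; apply: subst_sub => y /au /= yu z; rewrite /t (yu : y \in u).
  case: ifP => [ys|_]; first by rewrite mem_cat orbb vu => /su.
  by case: ifP => _; rewrite ?inE ?mem_cat ?orbb // => /eqP->; rewrite vu.
have teven a z : all (mem u) a -> parity z (subst t a) = false.
  move=> /allP au; apply: parity_subst => y /au /= yu; rewrite /t (yu : y \in u).
  by do 2?[case: ifP => _]; rewrite ?parity_cat ?addbb // !parity_cons addbA addbb.
have u1s' : all (mem s) u1 by apply/allP => y /=; rewrite -u1i.
have ssu : all (mem u) s by apply/allP.
have tx : t x = [:: x; x] by rewrite /t (negPf xs) eqxx.
have sv' : {subset s <= v} by apply: vv.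
split; last 1 first.
- have -> : (s ++ s) ++ subst t u ++ v = W ++ x :: (x :: subst t u2 ++ v).
    by rewrite uE subst_cat subst_cons tx /W -!catA.
  rewrite -{1}(Wfirst u1 u1s'); apply: prefix_first_occ_cat.
  by rewrite -mem_first_occ (Wfirst u1 u1s').
- apply: (@transfer_subst _ _ _ tr t [:: s ++ s; [:: x; x]; v ++ v; v ++ p ++ v ++ p]) => //.
  + by move=> y; rewrite /t !inE; do 3?[case: ifP => _]; rewrite eqxx ?orbT.
  + move=> y; rewrite /t; case: ifP => [|_]; first by case: (s).
    by do 2?[case: ifP => _] => //; case: (v) v0.
  move=> a aA; have [au|au] := boolP (all (mem u) a).
    (* The image is even before the final [v], and the first letter of [a] outside [s], if any, is
       sent to [v ++ v]. *)
    apply: (closed_sim cC) Cv; split.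
    + rewrite catA undup_cat_sub // => y; rewrite mem_cat => /orP[|/(tu a au)//].
      by rewrite mem_cat orbb => /sv'.
    + have := nostart a aA; rewrite /starts au /=.
      have [a_s _|[b [y [c [aE bs ys]]]] ay] := split_notin s a.
        by rewrite catA first_occ_cat_prefix // Wfirst.
      have yx : (y == x) = false.
        apply: contraNF ay => /eqP<-; rewrite aE filter_cat filter_notin_nil /= ?ys //.
        by move=> z /(allP bs).
      have /andP[yu cu] : (y \in u) && all (mem u) c.
        by move: au; rewrite aE all_cat /= => /and3P[_ -> ->].
      have -> : (s ++ s) ++ subst t a ++ v =
          ((s ++ s) ++ subst t b) ++ (v ++ (v ++ subst t c ++ v)).
        by rewrite aE subst_cat subst_cons {2}/t (negPf ys) yx yu -!catA.
      have vE' : first_occ (v ++ v ++ subst t c ++ v) = first_occ v.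
        rewrite first_occ_cat_sub // => z; rewrite !mem_cat.
        by case/or3P=> // /(tu c cu).
      by rewrite first_occ_cat_prefix vE' // Wfirst.
    + move=> y; rewrite !parity_cat addbb teven //.
  (* The image of [a] contains [p], hence all letters of [A]. To place it in [H], [a] is split at
     its first letter [y] outside [s]. *)
  apply: (fu aA au).
    have Hp := CH Cp.
    have ins X c : {subset s <= X} -> x \in X -> H (X ++ v) ->
        H (X ++ subst t c ++ v).
      move=> sX xX HX; apply: (closed_insert cH Hp Hv HX) => _ /mapP[y _ ->].
      rewrite /t; case: ifP => [_|_]; last case: ifP => [_|_]; last case: ifP => [_|_].
      - constructor 1; split=> z; rewrite ?parity_cat ?addbb // mem_cat orbb.
          exact: sX.
        exact: sv'.
      - constructor 1; split=> z; rewrite ?parity_cons ?addbA ?addbb // !inE orbb;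
        by move=> /eqP->; rewrite ?vu.
      - by constructor 2.
      - by constructor 3.
    have prepend b Z : all (mem s) b -> H (v ++ Z) ->
        H (((s ++ s) ++ subst t b) ++ v ++ Z).
      move=> bs; apply: (closed_sim cH); split.
      - by rewrite [RHS]undup_cat_sub // => y /(Wsub _ bs)/sv' yv; rewrite mem_cat yv.
      - rewrite [RHS]first_occ_cat_prefix // Wfirst // (first_occ_cat v).
        exact: prefix_trans sv (prefix_prefix _ _).
      - move=> y; rewrite !parity_cat addbb teven //; apply/allP => z /(allP bs)/su //.
    have [a_s|[b [y [c [aE bs ys]]]]] := split_notin s a.
      by move/negP: au; case; apply/allP => z /(allP a_s)/su.
    have [yx|yx] := eqVneq y x.
      have -> : (s ++ s) ++ subst t a ++ v =
          (((s ++ s) ++ subst t b) ++ [:: x; x]) ++ subst t c ++ v.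
        by rewrite aE subst_cat subst_cons yx tx -!catA.
      apply: ins; first by move=> z zs; rewrite !mem_cat zs.
        by rewrite !(mem_cat, inE) eqxx !orbT.
      (* The prefix [k] of [u] has first occurrences [s], [x]. Grafting [v ++ v] after it and
         appending [u ++ v] gives a member of [H] similar to [X ++ v]. *)
      have uE' : u = (u1 ++ [:: x]) ++ u2 by rewrite -catA.
      have [k kE] : exists k, k = u1 ++ [:: x] by exists (u1 ++ [:: x]).
      rewrite -kE in uE'.
      have ks : first_occ k = rcons s x.
        by rewrite kE first_occ_cat u1s /= -mem_first_occ u1s xs cats1.
      have Xs : first_occ (((s ++ s) ++ subst t b) ++ [:: x; x]) = rcons s x.
        have e : [:: x; x] = [:: x] ++ [:: x] by [].
        rewrite e catA first_occ_cat_sub; last first.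
          by move=> z; rewrite mem_cat orbC => ->.
        by rewrite first_occ_cat Wfirst //= -mem_first_occ Wfirst // xs cats1.
      move: Xs; set X := _ ++ [:: x; x] => Xs.
      have Xk : X =i k by move=> z; rewrite -mem_first_occ Xs -ks mem_first_occ.
      have ku : {subset k <= v} by apply: vv => z zk; rewrite uE' mem_cat zk.
      have u2v : {subset u2 <= v} by apply: vv => z zk; rewrite uE' mem_cat zk orbT.
      have uv : {subset u <= v} by apply: vv.
      have kvu z : z \in (k ++ (v ++ v) ++ k ++ k ++ u2) ++ u -> z \in v.
        rewrite !mem_cat => zin; have : [|| z \in k, z \in v, z \in u2 | z \in u].
          by move: zin; do 4!case: (_ \in _).
        by case/or4P => [/ku||/u2v|/uv].
      have HY : H ((k ++ (v ++ v) ++ k ++ k ++ u2) ++ u ++ v).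
        by apply: closed3 => //; apply: closed_graft; rewrite // -uE'.
      apply: (closed_sim cH) HY; split.
      + rewrite catA [LHS]undup_cat_sub ?[RHS]undup_cat_sub // => z.
        by rewrite Xk => /ku.
      + have -> : (k ++ (v ++ v) ++ k ++ k ++ u2) ++ u ++ v =
            k ++ v ++ ((v ++ k ++ k ++ u2) ++ u ++ v) by rewrite -!catA.
        rewrite first_occ_cat (first_occ_cat X) first_occ_cat_sub; last first.
          move=> z zz; apply: kvu; move: zz; rewrite !mem_cat.
          by do 4!case: (_ \in _).
        by rewrite Xs ks; congr (_ ++ _); apply: eq_filter => z; rewrite Xk.
      + have bu : all (mem u) b by apply/allP => w /(allP bs)/su.
        move=> z; rewrite uE' !(parity_cat, parity_cons) (teven b) // (@parity0 _ z [::]) //.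
        by case: (x == z); do !case: (parity _ _).
    have [yu|yu] := boolP (y \in u).
      have -> : (s ++ s) ++ subst t a ++ v =
          ((s ++ s) ++ subst t b) ++ (v ++ (v ++ subst t c ++ v)).
        by rewrite aE subst_cat subst_cons {2}/t (negPf ys) (negPf yx) yu -!catA.
      apply: prepend => //; rewrite catA; apply: ins.
      - by move=> z /sv' zv; rewrite mem_cat zv.
      - by rewrite mem_cat vu xu.
      - by rewrite -catA; apply: closed3.
    have -> : (s ++ s) ++ subst t a ++ v =
        ((s ++ s) ++ subst t b) ++ (v ++ ((p ++ v ++ p) ++ subst t c ++ v)).
      by rewrite aE subst_cat subst_cons {2}/t (negPf ys) (negPf yx) (negPf yu) -!catA.
    apply: prepend => //; rewrite catA; apply: ins.
    - by move=> z /sv' zv; rewrite mem_cat zv.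
    - by rewrite mem_cat vu xu.
    - by rewrite -!catA; do 2!apply: closed3 => //.
  have [z za zu0] := allPn au; have zu : z \notin u := zu0.
  move=> b bA y yb; rewrite !mem_cat (mem_subst za) ?orbT // /t (negPf zu) !ifF.
  + by rewrite !mem_cat (pA b) // orbT.
  + by apply: contraNF zu => /eqP->.
  + by apply: contraNF zu => /su.
- move=> y; rewrite !mem_cat orbb; apply/idP/idP => [/or3P[/su//|/tu|]|].
  + by rewrite vu; apply; apply/allP.
  + by rewrite vu.
  + by rewrite -vu => ->; rewrite !orbT.
Qed.

Lemma transfer_first_occ :
  exists v, [/\ C v, v =i u & first_occ v = first_occ u].
Proof.
have [v [Cv vu]] : exists v, [/\ C v, v =i u & prefix (first_occ u) (first_occ v)].
  have : prefix (first_occ u) (first_occ u) by exact: prefix_refl.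
  elim/last_ind: {1 3}(first_occ u) => [_|s x IH sxu].
    by have [v Cv vu] := transfer_content; exists v; split; rewrite ?prefix0s.
  have [|v [Cv vu sv]] := IH.
    by apply: prefix_trans sxu; rewrite -cats1 prefix_prefix.
  exact: transfer_first_occ_step sv.
move=> /prefixP[s vE]; exists v; split=> //.
have : uniq (first_occ v) by rewrite rev_uniq undup_uniq.
have sv x : x \in s -> x \in first_occ u.
  by rewrite mem_first_occ -vu -(mem_first_occ v) vE mem_cat => ->; rewrite orbT.
case: s sv vE => [|x s] sv ->; rewrite ?cats0 // cat_uniq => /and3P[_ /hasP[]].
by exists x; rewrite ?mem_head //=; apply: sv; rewrite mem_head.
Qed.

End Main.
Lemma odd_count_addb (p q : pred T) w :
  odd (count (fun x => p x (+) q x) w) = odd (count p w) (+) odd (count q w).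
Proof.
elim: w => //= x w IH; rewrite !oddD IH; case: (p x) (q x) => [] [] /=;
by do 2!case: odd.
Qed.

(* An affine subspace of the parity vectors that misses a given vector is
   separated from it by a linear functional. *)
Lemma parity_separation (D : seq T -> Prop) (L : seq T) u : (exists d, D d) ->
    (forall a b c, D a -> D b -> D c -> D (a ++ b ++ c)) ->
  (exists2 d, D d & {in L, forall x, parity x d = parity x u}) \/
  exists (p : pred T) (e : bool),
    (forall d, D d -> odd (count p d) = e) /\ odd (count p u) = ~~ e.
Proof.
elim: L D => [|x L IH] D [d Dd] D3; first by left; exists d.
have [[d0 [Dd0 xd0]]|D0] := EM (exists d, D d /\ parity x d = parity x u); last first.
  right; exists (pred1 x), (~~ parity x u); rewrite negbK; split=> // d' Dd'.
  by apply/eqP; rewrite -[_ == _]negbK; apply/negP => /negP h; apply: D0;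
    exists d'; split=> //;
    move: h; rewrite /parity; do 2!case: odd.
have [||[d' [Dd' xd'] Ld']|[p [e [pD pu]]]] :=
  IH (fun d => D d /\ parity x d = parity x u).
- by exists d0.
- move=> a b c [Da xa] [Db xb] [Dc xc]; split; first exact: D3.
  by rewrite !parity_cat xa xb xc; case: parity.
- by left; exists d' => // y; rewrite inE => /orP[/eqP->|/Ld'].
right.
(* [p] is constant on the words of [D] that agree with [u] at [x]. If it is not so on all of [D],
   adding the coordinate of [x] repairs this. *)
have [[d1 [Dd1 pd1]]|no] := EM (exists d1, D d1 /\ odd (count p d1) = ~~ e); last first.
  exists p, e; split=> // d' Dd'; apply/eqP; rewrite -[_ == _]negbK; apply/negP => h.
  by apply: no; exists d'; split=> //; move: h; case: odd (e) => [] [].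
have pdE d' : D d' -> odd (count p d') = e (+) (parity x d' (+) parity x u).
  move=> Dd'; have [xd'|xd'] := eqVneq (parity x d') (parity x u).
    by rewrite pD // xd' addbb addbF.
  have xd1 : parity x d1 != parity x u.
    by apply/eqP => xd1; have := pD d1 (conj Dd1 xd1); rewrite pd1; case: (e).
  (* Neither [d'] nor [d1] agrees with [u] at [x], so their product with [d0] does. *)
  have := pD (d' ++ d1 ++ d0); rewrite !count_cat !oddD pd1 (pD d0) // !parity_cat => pd.
  have := pd (conj (D3 _ _ _ Dd' Dd1 Dd0) _); move: xd' xd1; rewrite xd0.
  by do 3!case: parity => //; case: odd (e) => [] [] // _ _ /(_ erefl).
exists (fun y => p y (+) (y == x)), (e (+) parity x u); split.
  move=> d' Dd'; rewrite odd_count_addb pdE //= -/(parity x d').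
  by do 2!case: parity; case: (e).
by rewrite odd_count_addb pu -/(parity x u); case: parity; case: (e).
Qed.

End Transfer.

(** * Transfer of the parities *)

Section TransferParity.
Variables (T : eqType) (A : seq (seq T)) (C H : seq T -> Prop).
Hypothesis tr : transfer A C H.
Hypothesis A0 : A != [::].
Let cC := transfer_C tr.
Let cH := transfer_H tr.
Let CH := transfer_CH tr.
Implicit Types (x y : T) (u v w : seq T).

(** If the parities of [u] are missed, let [p] separate them. Sending letters of [u] to [g = u ++ v]
    or its square according to [p] makes words of [A] over [u] similar to [v], whereas the image of
    [u] has the parities of [g ++ v], which are those of [u]. *)
Lemma transfer_parity u : H u -> full A C H u -> has (all (mem u)) A ->
  exists w, [/\ C w, {subset w <= u} & forall x, parity x w = parity x u].
Proof.
move=> Hu fu Au.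
have [v Cv vu] := transfer_content tr A0 Hu fu Au; have Hv := CH Cv.
pose D w := C w /\ {subset w <= u}.
have [||[w [Cw wu] wE]|[p [e [pD pu]]]] := @parity_separation T D u u.
- by exists v; split=> // x; rewrite vu.
- move=> a b c [Ca au] [Cb bu] [Cc cu]; split; first exact: closed3.
  by move=> x; rewrite !mem_cat => /or3P[/au|/bu|/cu].
- exists w; split=> // x; have [/wE//|xu] := boolP (x \in u).
  by rewrite !parity0 //; apply: contra xu => /wu.
have [q Cq qA] := total_word tr A0; have Hq := CH Cq.
have v0 := closed_neq0 cC Cv; have q0 := closed_neq0 cC Cq.
have [g gE] : exists g, g = u ++ v by exists (u ++ v).
have gv : g =i v by move=> x; rewrite gE mem_cat vu orbb.
have g0 : g != [::] by rewrite gE; case: (v) v0 => // x w _; case: (u).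
(* A word of [A] over the letters of [u] then has an even number of factors [g]
   after [l], and [u] an odd number. *)
pose s y := if y \in u then if p y then g else g ++ g else q ++ q.
(* The factor [v ++ v] fixes the order of first occurrences; [g] is added when words of [A] would
   otherwise give an odd number of factors [g]. *)
have [l lE] : exists l, l = (v ++ v) ++ flatten (if e then [:: g] else [::]) by eexists.
have ps a x : {subset a <= u} ->
    parity x (subst s a) = odd (count p a) && parity x g.
  elim: a => // y a IH au; rewrite subst_cons parity_cat IH; last first.
    by move=> z za; apply: au; rewrite inE za orbT.
  rewrite /s au ?mem_head //= oddD oddb; case: (p y); rewrite ?parity_cat ?addbb //=.
  by case: odd; case: parity.
have sv a : {subset a <= u} -> {subset subst s a <= v}.
  move=> au; apply: subst_sub => y /au yu x; rewrite /s yu; case: ifP => _;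
  by rewrite ?mem_cat ?orbb gv.
have lv : {subset l <= v}.
  by move=> x; rewrite lE !mem_cat orbb => /orP[//|]; case: (e) => //=; rewrite cats0 gv.
have pl x : parity x l = e && parity x g.
  by rewrite lE !parity_cat addbb /=; case: (e); rewrite //= cats0.
have Hg : exists c d, [/\ H c, H d & g = c ++ d] by exists u, v.
have Hgg : exists c d, [/\ H c, H d & g ++ g = c ++ d].
  exists (u ++ v ++ u), v; split=> //; first exact: closed3.
  by rewrite gE -!catA.
exists (l ++ subst s u ++ v); split.
- apply: (transfer_subst tr (vals := [:: g; g ++ g; q ++ q])) => //.
  + by move=> x; rewrite /s !inE; do 2?[case: ifP => _]; rewrite eqxx ?orbT.
  + move=> x; rewrite /s; case: ifP => _; last by case: (q) q0.
    by case: ifP => _ //; case: (g) g0.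
  move=> a aA; have [au0|au0] := boolP (all (mem u) a).
    have au : {subset a <= u} by apply/allP.
    apply: (closed_sim cC) Cv; split.
    + rewrite catA undup_cat_sub // => x; rewrite mem_cat => /orP[/lv//|/(sv _ au)//].
    + rewrite lE -!catA first_occ_cat_sub // => x; rewrite !mem_cat => /or4P[//||/(sv _ au)//|//].
      by case: (e) => //=; rewrite cats0 gv.
    + have ae : odd (count p a) = e by apply: pD; split=> //; apply: (transfer_AC tr).
      by move=> x; rewrite !parity_cat pl ps // ae addKb.
  apply: (fu a) => //.
    have -> : l ++ subst s a ++ v =
        flatten ((v ++ v) :: (if e then [:: g] else [::]) ++ map s a) ++ v.
      by rewrite lE /= flatten_cat -!catA.
    apply: closed_flatten => // b; rewrite inE mem_cat => /or3P[/eqP->||].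
    - by exists v, v.
    - by case: (e) => //; rewrite inE => /eqP->.
    - move=> /mapP[y _ ->]; rewrite /s; case: ifP => _; last by exists q, q.
      by case: ifP.
  have [x xa xu0] := allPn au0; have xu : x \notin u := xu0.
  move=> b bA y yb; rewrite !mem_cat (mem_subst xa) ?orbT // /s (negPf xu) mem_cat.
  by rewrite (qA b).
- by move=> x; rewrite !mem_cat -vu => /or3P[/lv|/sv|//]; apply.
- move=> x; rewrite !parity_cat pl ps // pu gE parity_cat.
  by case: (e); do !case: parity.
Qed.

End TransferParity.

Section TransferTotal.
Variable T : eqType.
Implicit Types (A : seq (seq T)) (C H : seq T -> Prop).

(** [v1], [rev v2] and [v3] have the first occurrences, the last occurrences and the parities of
    [u]; their product with [v1] and [rev v2] doubled has all three. *)
Lemma transfer_full A C H u : transfer A C H -> A != [::] ->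
  H u -> full A C H u -> C u.
Proof.
move=> tr A0 Hu fu.
have [Au|/(transfer_disjoint tr A0 Hu fu)//] := boolP (has (all (mem u)) A).
have [v1 [C1 v1u v1E]] := transfer_first_occ tr A0 Hu fu Au.
have [|||v2 [C2 v2u v2E]] :=
  @transfer_first_occ _ _ _ _ (transfer_rev tr) _ (rev u) _ (full_rev fu).
- by rewrite -size_eq0 size_map size_eq0.
- by rewrite revK.
- case/hasP: Au => a aA /allP au; apply/hasP; exists (rev a); first exact: map_f.
  by apply/allP => x; rewrite mem_rev => /au xu; rewrite /= mem_rev.
have [v3 [C3 v3u v3E]] := transfer_parity tr A0 Hu fu Au.
have {}v2u : rev v2 =i u by move=> x; rewrite mem_rev v2u mem_rev.
have cC := transfer_C tr.
have : C (v1 ++ (v1 ++ v3 ++ rev v2) ++ rev v2) by do 2!apply: closed3 => //.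
apply: (closed_sim cC); split.
- rewrite catA undup_cat_sub.
    by apply: (can_inj revK); move: v2E; rewrite /first_occ revK.
  by move=> x; rewrite !mem_cat v1u v2u => /or4P[//|//|/v3u//|//].
- rewrite first_occ_cat_sub // => x; rewrite !mem_cat v1u v2u.
  by rewrite -!orbA => /or4P[//|/v3u//|//|//].
- by move=> x; rewrite !parity_cat v3E; do !case: parity.
Qed.

(** Two passes: [full] is vacuous for words that contain all letters of [A], and their transfer
    supplies [full] for every word. *)
Lemma transfer_total A C H u : transfer A C H -> A != [::] -> H u -> C u.
Proof.
move=> tr A0 Hu; apply: (transfer_full tr) => // a w aA _ Hw Aw.
apply: (transfer_full tr) => // b w' bA /negP[]; apply/allP; exact: Aw.
Qed.

End TransferTotal.

(** * Identities and invariants of varieties *)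

Fixpoint words (t : term) : seq (seq nat) :=
  match t with
  | Var i => [:: [:: i]]
  | Add t1 t2 => words t1 ++ words t2
  | Mul t1 t2 => [seq u ++ v | u <- words t1, v <- words t2]
  end.

Lemma words_neq0 t : words t != [::].
Proof.
elim: t => //= t1 + t2; first by case: (words t1).
by case: (words t1) => // u ? _; case: (words t2).
Qed.

Section TermOrder.
Variable S : aiSemiring.
Implicit Types (v : nat -> S) (x y z : S) (l r : option S).
Local Notation "x ** y" := (omul x y) (at level 40, left associativity).
Local Notation "x <== y" := (ole x y) (at level 70).

Lemma ole_add l r x y z : l ** Some (add x y) ** r <== Some z <->
  l ** Some x ** r <== Some z /\ l ** Some y ** r <== Some z.
Proof.
have addP a b : add (add a b) z = z <-> add a z = z /\ add b z = z.
  split=> [abz|[az bz]]; last by rewrite -addA bz.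
  split; rewrite -[in LHS]abz -?addA !addA; last first.
    by rewrite [add b a]addC -[add (add a b) b]addA addxx.
  by rewrite addxx.
by case: l r => [l|] [r|]; rewrite /omul /= ?mulDr ?mulDl; apply: addP.
Qed.

(** The context [l], [r] carries the induction through products. *)
Lemma ole_evalP v t l r z : l ** Some (eval v t) ** r <== Some z <->
  forall w, w \in words t -> l ** oprod v w ** r <== Some z.
Proof.
elim: t l r => [i|t1 IH1 t2 IH2|t1 IH1 t2 IH2] l r /=.
- split=> [h w|h]; first by rewrite inE => /eqP->.
  exact: (h [:: i] (mem_head _ _)).
- rewrite ole_add IH1 IH2; split=> [[h1 h2] w|h].
    by rewrite mem_cat => /orP[/h1|/h2].
  by split=> w wt; apply: h; rewrite mem_cat wt ?orbT.
- have -> : l ** Some (mul (eval v t1) (eval v t2)) ** r =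
      l ** Some (eval v t1) ** (Some (eval v t2) ** r).
    by rewrite omulA -[in RHS](omulA l).
  rewrite IH1; split=> [h w /allpairsP[[u1 u2] /= [u1t u2t ->]]|h u1 u1t].
    move: (h _ u1t); rewrite omulA IH2 => /(_ _ u2t).
    by rewrite oprod_cat omulA.
  rewrite omulA; apply/IH2 => u2 u2t.
  by rewrite -(omulA l) -oprod_cat; apply: h; apply: allpairs_f.
Qed.

Lemma eval_leP v t z : Some (eval v t) <== Some z <->
  forall w, w \in words t -> oprod v w <== Some z.
Proof.
have := @ole_evalP v t None None z; rewrite omulo1 omul1o => ->.
by split=> h w /h; rewrite omulo1 omul1o.
Qed.

Lemma oprod_subst (T : eqType) (f g : T -> S) (s : T -> seq T) (w : seq T) :
  (forall i, Some (g i) = oprod f (s i)) -> oprod f (subst s w) = oprod g w.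
Proof.
by move=> gs; elim: w => // i w IH; rewrite subst_cons oprod_cat oprod_cons gs IH.
Qed.

Lemma oprod_map (T U : eqType) (f : U -> S) (k : T -> U) (w : seq T) :
  oprod f (map k w) = oprod (f \o k) w.
Proof. by elim: w => // i w; rewrite map_cons !oprod_cons => ->. Qed.

End TermOrder.

Lemma closed_forall (T : eqType) (I : Type) (D : I -> seq T -> Prop) :
  inhabited I -> (forall i, closed (D i)) -> closed (fun w => forall i, D i w).
Proof.
move=> [i0] cD; split.
- by move=> w /(_ i0); apply: closed_neq0.
- by move=> u v uv Du i; apply: closed_sim uv _.
- by move=> u v a b c ? ? ? Da Db Dc i; have [_ _ D3] := cD i; apply: D3.
Qed.

(** * Valuations with four values suffice *)

Section FourValues.
Variable S : aiSemiring.
Hypothesis cube : forall a : S, mul a (mul a a) = a.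
Local Notation "x <== y" := (ole x y) (at level 70).

Lemma eval_le_four s t :
    (forall (k : nat -> 'I_4) (f : 'I_4 -> S),
       Some (eval (f \o k) s) <== Some (eval (f \o k) t)) ->
  forall v : nat -> S, Some (eval v s) <== Some (eval v t).
Proof.
move=> st v; apply/eval_leP => w ws.
pose below (v : nat -> S) w := oprod v w <== Some (eval v t).
pose H w := forall kf : (nat -> 'I_4) * ('I_4 -> S), below (kf.2 \o kf.1) w.
have Hw : H w by move=> [k f]; apply: (eval_leP _ _ _).1 ws; apply: st.
have below_words v' a : a \in words t -> below v' a.
  by move=> at_; apply: (eval_leP _ _ _).1 at_; apply: ole_refl.
have below_subst v' (g : nat -> seq nat) vals l u r :
    size vals <= 4 -> (forall x, g x \in vals) -> (forall x, g x != [::]) ->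
    H u -> (forall a, a \in words t -> below v' (l ++ subst g a ++ r)) ->
    below v' (l ++ subst g u ++ r).
  move=> sz gv g0 Hu Ha.
  (* A substitution with at most four values, followed by [v'], factors through ['I_4]: [k] is the
     position of the value in [vals], [f] its evaluation. *)
  pose k x : 'I_4 := inord (index (g x) vals).
  pose f (i : 'I_4) := odflt (v' 0) (oprod v' (nth [::] vals i)).
  have fk x : Some ((f \o k) x) = oprod v' (g x).
    rewrite /f /k /= inordK ?nth_index //.
      by have := isSome_oprod v' (g x); rewrite g0; case: oprod.
    by apply: leq_trans sz; rewrite index_mem.
  have ole3 : ole (omul (omul (oprod v' l) (Some (eval (f \o k) t))) (oprod v' r))
      (Some (eval v' t)).
    apply/ole_evalP => a /Ha; rewrite /below !oprod_cat omulA.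
    by rewrite (oprod_subst _ fk).
  rewrite /below !oprod_cat omulA (oprod_subst _ fk).
  by apply: ole_trans ole3; apply/ole_mul2r/ole_mul2l; apply: (Hu (k, f)).
have cH : closed H.
  apply: closed_forall; last by move=> [k f]; apply: closed_ole.
  by constructor; exact: (fun=> ord0, fun=> v 0).
suff tr : transfer (words t) (fun w => H w /\ below v w) H.
  by have [] := transfer_total tr (words_neq0 t) Hw.
split=> //.
- by apply: closed_and => //; apply: closed_ole.
- by move=> ? [].
- by move=> a at_; split=> [kf|]; apply: below_words.
- move=> g vals l u r sz gv g0 Hu Ca; split=> [kf|].
    by apply: (below_subst _ _ vals) => // a /Ca[/(_ kf)].
  by apply: (below_subst _ _ vals) => // a /Ca[].
Qed.

End FourValues.

(** The codomain is finite. Duplicate-free sequences over four letters have length at most four, so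
    [insub_bseq] loses nothing. *)
Definition invariant (w : seq 'I_4) : 4.-bseq 'I_4 * 4.-bseq 'I_4 * {ffun 'I_4 -> bool} :=
  (insub_bseq 4 (undup w), insub_bseq 4 (first_occ w), [ffun x => parity x w]).

Lemma invariant_similar u v : invariant u = invariant v -> similar u v.
Proof.
have bseqK (w : seq 'I_4) : uniq w -> insub_bseq 4 w = w :> seq 'I_4.
  move=> /card_uniqP wE; rewrite insubdK //= -topredE /= -wE.
  by have := max_card (mem w); rewrite card_ord.
case=> /(congr1 val) h1 /(congr1 val) h2 /ffunP h3; move: h1 h2.
rewrite /= !bseqK ?rev_uniq ?undup_uniq // => h1 h2.
by split=> // x; have := h3 x; rewrite !ffunE.
Qed.

Definition term_invariant (k : nat -> 'I_4) t :=
  [set i in [seq invariant (map k w) | w <- words t]].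

Lemma eval_term_invariant (S : aiSemiring) (f : 'I_4 -> S) k k' t t' :
    (forall a : S, mul a (mul a a) = a) ->
    term_invariant k t = term_invariant k' t' ->
  eval (f \o k) t = eval (f \o k') t'.
Proof.
move=> cube tt'.
suff le h h' s s' : term_invariant h s = term_invariant h' s' ->
    ole (Some (eval (f \o h) s)) (Some (eval (f \o h') s')).
  by have /Some_inj := ole_anti (le _ _ _ _ tt') (le _ _ _ _ (esym tt')).
move=> ss'; apply/eval_leP => w ws.
have : invariant (map h w) \in term_invariant h s.
  by rewrite inE; apply: map_f.
rewrite ss' inE => /mapP[w' w's /invariant_similar ww'].
rewrite -oprod_map (oprod_similar _ _ ww') // oprod_map.
by apply: (eval_leP _ _ _).1 w's; apply: ole_refl.
Qed.

Definition holds_four (K : set aiSemiring) (k : nat -> 'I_4) (e : identity) :=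
  forall (S : aiSemiring) (f : 'I_4 -> S), K S -> eval (f \o k) e.1 = eval (f \o k) e.2.

Definition variety_invariant (K : set aiSemiring) :=
  [set p | `[< exists k e, holds_four K k e /\
     p = (term_invariant k e.1, term_invariant k e.2) >]]%SET.

(** Each four-valued instance of an identity of [K] shares its invariants with one that holds in
    [L], hence holds in [L]; [eval_le_four] extends this to all valuations. *)
Lemma variety_invariant_sub (K L : set aiSemiring) :
    (forall (S : aiSemiring) (a : S), L S -> mul a (mul a a) = a) -> variety K ->
    variety_invariant K = variety_invariant L ->
  (L `<=` K)%classic.
Proof.
move=> cube [E ->] KL S LS [s t] Est v.
have st k (f : 'I_4 -> S) : eval (f \o k) s = eval (f \o k) t.
  have : (term_invariant k s, term_invariant k t) \in variety_invariant (models E).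
    rewrite inE; apply/asboolP; exists k, (s, t); split=> // S' f' ES'.
    exact: (ES' _ Est).
  rewrite KL inE => /asboolP[k' [[s' t'] [Lst [ss' tt']]]].
  rewrite (eval_term_invariant _ _ ss') ?(eval_term_invariant _ _ tt') //.
  - exact: Lst.
  - by move=> a; apply: cube.
  - by move=> a; apply: cube.
have cubeS a : mul a (mul a a) = a :> S by apply: cube.
have le s' t' : (forall k (f : 'I_4 -> S), eval (f \o k) s' = eval (f \o k) t') ->
    ole (Some (eval v s')) (Some (eval v t')).
  by move=> e; apply: eval_le_four => // k f; rewrite e; apply: ole_refl.
by have /Some_inj := ole_anti (le _ _ st) (le _ _ (fun k f => esym (st k f))).
Qed.

Lemma countable_subvarieties (V : set aiSemiring) :
    (forall (S : aiSemiring) (a : S), V S -> mul a (mul a a) = a) ->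
  countable (subvarieties V).
Proof.
move=> cube; apply/countable_injP.
exists (fun K => pickle (variety_invariant K)).
move=> K L; rewrite !inE => -[varK KV] [varL LV] /(pcan_inj pickleK) KL.
apply/seteqP; split; apply: variety_invariant_sub => // S a.
- by move=> /KV; apply: cube.
- by move=> /LV; apply: cube.
Qed.

(** * Flat extensions of Heisenberg groups *)

Import GRing.Theory.

Section Flat.
Local Open Scope ring_scope.
Variable F : finFieldType.
Implicit Types g h : F * F * F.

(* The triple [(a, b, c)] stands for the unitriangular 3x3 matrix with
   superdiagonal [a, b] and corner entry [c]. *)
Definition heis_mul g h : F * F * F :=
  (g.1.1 + h.1.1, g.1.2 + h.1.2, g.2 + h.2 + g.1.1 * h.1.2).

Definition heis_inv g : F * F * F := (- g.1.1, - g.1.2, - g.2 + g.1.1 * g.1.2).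

Definition heis_bracket g h : F := g.1.1 * h.1.2 - h.1.1 * g.1.2.

Lemma heis_mulA : associative heis_mul.
Proof. by move=> [[a b] c] [[a' b'] c'] [[a2 b2] c2]; congr (_, _, _) => /=; ring. Qed.

Lemma heis_mulI g : injective (heis_mul g).
Proof.
case: g => [[a b] c] [[a1 b1] c1] [[a2 b2] c2] [] /addrI-> /addrI-> /addIr/addrI -> //.
Qed.

Lemma heis_mulIr g : injective (heis_mul^~ g).
Proof.
case: g => [[a b] c] [[a1 b1] c1] [[a2 b2] c2] [] /addIr-> /addIr-> /addIr/addIr -> //.
Qed.

(** The power is [k.+1], and the binomial counts the products [a * b] in the corner: exponent [m]
    means that [m] and ['C(m, 2)] vanish in [F]. *)
Lemma heis_iter g k : iter k (heis_mul g) g =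
  (g.1.1 *+ k.+1, g.1.2 *+ k.+1, g.2 *+ k.+1 + (g.1.1 * g.1.2) *+ 'C(k.+1, 2)).
Proof.
case: g => [[a b] c]; elim: k => [|k IH] /=.
  by rewrite !mulr1n bin_small // mulr0n addr0.
rewrite IH /heis_mul /= -!mulrS; congr (_, _, _).
by rewrite addrA -mulrS [in RHS]binS bin1 [in RHS]mulrnDr mulrnAr -addrA.
Qed.

(* The group is encoded in [nat] because, for universe reasons, no type built
   from [F] can be the carrier of an [aiSemiring]. *)
Local Notation G := {i : nat | (i < #|{: F * F * F}|)%N}.
Implicit Types (x y z : option G) (a b c : G).

Definition pt g : option G := Some (exist _ (val (enum_rank g)) (ltn_ord _)).

Definition of_pt a : F * F * F := enum_val (Ordinal (proj2_sig a)).

Lemma ptK g : of_pt (exist _ (val (enum_rank g)) (ltn_ord _)) = g.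
Proof. by rewrite -[RHS]enum_rankK; congr enum_val; apply: val_inj. Qed.

Lemma pt_inj : injective pt.
Proof. by move=> g h [] /val_inj/enum_rank_inj. Qed.

Lemma of_ptK a : pt (of_pt a) = Some a.
Proof. by congr Some; apply: val_inj; rewrite /= enum_valK. Qed.

Lemma ptP x : x = None \/ exists g, x = pt g.
Proof.
by case: x => [a|]; [right; exists (of_pt a); rewrite of_ptK | left].
Qed.

(** [None] is a top element, absorbing for both operations, so distributivity comes down to
    cancellation in the group. *)
Definition flat_add x y := if x == y then x else None.

Definition flat_mul x y :=
  match x, y with
  | Some a, Some b => pt (heis_mul (of_pt a) (of_pt b))
  | _, _ => None
  end.

Lemma flat_mulE g h : flat_mul (pt g) (pt h) = pt (heis_mul g h).
Proof. by rewrite /= !ptK. Qed.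

Lemma flat_mulN x : flat_mul x None = None. Proof. by case: x. Qed.

Lemma flat_addN x : flat_add x None = None.
Proof. by rewrite /flat_add; case: eqP => // ->. Qed.

Lemma flat_add_eqS x y g : flat_add x y = pt g <-> x = pt g /\ y = pt g.
Proof.
by rewrite /flat_add; split=> [|[-> ->]]; [case: eqP => // <- | rewrite eqxx].
Qed.

Lemma flat_addA : associative flat_add.
Proof.
move=> x y z; rewrite /flat_add; have [<-|yz] := eqVneq y z.
  by case: (eqVneq x y) => [->|xy]; rewrite ?eqxx //; case: y xy.
have [xy|xy] := eqVneq x y; first by rewrite xy (negPf yz); case: (y).
by case: x xy => //; case: (z).
Qed.

Lemma flat_addC : commutative flat_add.
Proof. by move=> x y; rewrite /flat_add eq_sym; case: eqP. Qed.

Lemma flat_addxx : idempotent_op flat_add.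
Proof. by move=> x; rewrite /flat_add eqxx. Qed.

Lemma flat_mulA : associative flat_mul.
Proof.
move=> x y z; case: (ptP x) (ptP y) (ptP z) => [->|[g ->]] [->|[h ->]] [->|[k ->]] //.
by rewrite !flat_mulE heis_mulA.
Qed.

Lemma flat_mulDr : right_distributive flat_mul flat_add.
Proof.
move=> x y z; case: (ptP x) (ptP y) (ptP z) => [->|[g ->]] [->|[h ->]] [->|[k ->]] //;
  rewrite ?flat_mulN ?flat_addN ?flat_mulN // [flat_add _ (pt k)]flat_addC ?flat_addN //.
rewrite flat_addC /flat_add !flat_mulE !(inj_eq pt_inj) (inj_eq (@heis_mulI g)).
by case: ifP => _; rewrite ?flat_mulE ?flat_mulN.
Qed.

Lemma flat_mulDl : left_distributive flat_mul flat_add.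
Proof.
move=> x y z; case: (ptP x) (ptP y) (ptP z) => [->|[g ->]] [->|[h ->]] [->|[k ->]] //;
  rewrite ?flat_mulN ?flat_addN // [flat_add _ (pt h)]flat_addC ?flat_addN //.
rewrite flat_addC /flat_add !flat_mulE !(inj_eq pt_inj) (inj_eq (@heis_mulIr k)).
by case: ifP => _; rewrite ?flat_mulE.
Qed.

Definition flat_heis : aiSemiring :=
  @AiSemiring (option G) _ _ (inhabits None) flat_addA flat_addC flat_addxx
    flat_mulA flat_mulDr flat_mulDl.

End Flat.
Arguments pt : simpl never.
Arguments flat_mul : simpl never.
Arguments flat_add : simpl never.

(** * Identities that detect the order of the field *)

Section Identities.
Variable m : nat.

(** In a group of exponent [m], the power [t^(m - 1)] is the inverse of [t]. *)
Definition quotient s t := Mul s (iterop m.-1 Mul t t).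

Definition commutator s t := quotient (Mul s t) (Mul t s).

(** In a flat extension a sum is a group element only if all summands equal it, so sums express
    conjunctions of equations; [quotient y0 y0] in [premises] makes the common value 1. *)
Definition sum_terms (t : term) (u : nat -> term) n := iteri n (fun i => Add (u i)) t.

Let y0 := Var 0.
Let y1 := Var 1.
Let x i := Var i.+2.

Definition premises p d :=
  sum_terms
    (Add (quotient y0 y0) (Add (commutator y0 y1)
      (quotient (commutator (x (p ^ d)) y0) (commutator (x 1) y0))))
    (fun i => quotient (commutator (x i) y1) (commutator (x i.+1) y0)) (p ^ d).

(* In a flat extension of a group of exponent [m], the identity states that
   [y0, y1] = 1, [x i, y1] = [x (i + 1), y0] for i < p ^ d and
   [x (p ^ d), y0] = [x 1, y0] imply [x p, y0] = [x 1, y0]. Over a field,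
   y1 acts as a multiple z y0 of y0, so that z ^ (p ^ d) = z implies z ^ p = z. *)
Definition frobenius_identity p d : identity :=
  (premises p d,
   Add (premises p d) (quotient (commutator (x p) y0) (commutator (x 1) y0))).

Local Open Scope ring_scope.
Variable F : finFieldType.
Hypothesis m_gt1 : (1 < m)%N.
Hypothesis m0 : m%:R = 0 :> F.
Hypothesis binm0 : 'C(m, 2)%:R = 0 :> F.
Local Notation S := (flat_heis F).
Implicit Types (v : nat -> S) (g h : F * F * F).

Lemma eval_iterop v k t :
  eval v (iterop k.+1 Mul t t) = iter k (mul (eval v t)) (eval v t).
Proof. by elim: k => //= k <-. Qed.

Lemma iter_flat_mul k g : iter k (@mul S (pt g)) (pt g) = pt (iter k (heis_mul g) g).
Proof. by elim: k => // k IH; rewrite !iterS IH; exact: flat_mulE. Qed.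

Lemma mulrn_m (a : F) : a *+ m = 0.
Proof. by rewrite -mulr_natr m0 mulr0. Qed.

Lemma mulrn_binm (a : F) : a *+ 'C(m, 2) = 0.
Proof. by rewrite -mulr_natr binm0 mulr0. Qed.

Lemma heis_exp g : iter m (heis_mul g) g = g.
Proof.
case: g => [[a b] c]; rewrite heis_iter /= binS bin1 !mulrSr mulrnDr.
by rewrite !mulrn_m mulrn_binm !add0r addr0.
Qed.

Lemma heis_inv_exp g : iter m.-2 (heis_mul g) g = heis_inv g.
Proof.
have e : forall a : F, a *+ m.-1 = - a.
  move=> a; apply/eqP; rewrite -subr_eq0 opprK -mulrSr prednK ?(ltnW m_gt1) //.
  by rewrite mulrn_m.
have mE : (m.-2).+1 = m.-1 by case: (m) m_gt1 => [|[]].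
case: g => [[a b] c]; rewrite heis_iter /= mE !e /heis_inv /=; congr (_, _, _ + _).
have := mulrn_binm (a * b).
rewrite -[in 'C(m, 2)](prednK (ltnW m_gt1)) binS bin1 mulrnDr e => /eqP.
by rewrite subr_eq0 => /eqP.
Qed.

Lemma flat_sr : Sr m.+1 S.
Proof.
move=> _ -> v; rewrite /= -/eval (eval_iterop v m (Var 0)) /=.
by have [->|[g ->]] := ptP (v 0%N); [case: (m) | rewrite iter_flat_mul heis_exp].
Qed.

Lemma eval_quotient v s t g h : eval v s = pt g -> eval v t = pt h ->
  eval v (quotient s t) = pt (heis_mul g (heis_inv h)).
Proof.
move=> sg th; rewrite /= sg; have -> : m.-1 = m.-2.+1 by case: (m) m_gt1 => [|[]].
by rewrite eval_iterop th iter_flat_mul heis_inv_exp; exact: flat_mulE.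
Qed.

Lemma eval_quotient_some v s t g : eval v (quotient s t) = pt g ->
  exists a b, eval v s = pt a /\ eval v t = pt b.
Proof.
have -> : quotient s t = Mul s (iterop m.-2.+1 Mul t t).
  by rewrite /quotient; case: (m) m_gt1 => [|[]].
rewrite [eval v _]/= -/eval eval_iterop; have [->|[a ->]] // := ptP (eval v s).
have [->|[b ->]] := ptP (eval v t); last by exists a, b.
by case: (m.-2).
Qed.

Lemma eval_commutator v s t g h : eval v s = pt g -> eval v t = pt h ->
  eval v (commutator s t) = pt (0, 0, heis_bracket g h).
Proof.
move=> sg th; rewrite (@eval_quotient _ _ _ (heis_mul g h) (heis_mul h g)).
- case: g h {sg th} => [[a b] c] [[a' b'] c']; congr (pt (_, _, _)) => /=;
    rewrite /heis_bracket /=; ring.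
- by rewrite /= sg th; exact: flat_mulE.
- by rewrite /= sg th; exact: flat_mulE.
Qed.

Lemma eval_commutator_some v s t g : eval v (commutator s t) = pt g ->
  exists a b, eval v s = pt a /\ eval v t = pt b.
Proof.
move=> /eval_quotient_some[a [b [/=]]]; have [->|[a' ->]] // := ptP (eval v s).
by have [->|[b' ->]] // := ptP (eval v t); exists a', b'.
Qed.

Lemma eval_Add v s t g : eval v (Add s t) = pt g <->
  eval v s = pt g /\ eval v t = pt g.
Proof. exact: flat_add_eqS. Qed.

Lemma eval_AddN v s t : eval v s = None -> eval v (Add s t) = None.
Proof. by move=> /= ->; rewrite /flat_add; case: eqP. Qed.

Lemma eval_sum_terms v t u n g : eval v (sum_terms t u n) = pt g <->
  eval v t = pt g /\ forall i, (i < n)%N -> eval v (u i) = pt g.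
Proof.
elim: n => [|n IH] /=; first by split=> [|[]].
rewrite flat_add_eqS IH; split=> [[ung [tg ug]]|[tg ug]].
  by split=> // i; rewrite ltnS leq_eqVlt => /orP[/eqP->|/ug].
by split; [exact: ug | split=> // i /ltnW; exact: ug].
Qed.

Lemma eval_quotient_commutator v s t s' t' g h g' h' :
    eval v s = pt g -> eval v t = pt h -> eval v s' = pt g' -> eval v t' = pt h' ->
  eval v (quotient (commutator s t) (commutator s' t')) =
  pt (0, 0, heis_bracket g h - heis_bracket g' h').
Proof.
move=> sg th sg' th'.
rewrite (eval_quotient (eval_commutator sg th) (eval_commutator sg' th')).
by congr (pt (_, _, _)); rewrite /=; ring.
Qed.

Lemma eval_quotient_self v s g : eval v s = pt g -> eval v (quotient s s) = pt (0, 0, 0).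
Proof.
move=> sg; rewrite (eval_quotient sg sg).
by case: g {sg} => [[a b] c]; congr (pt (_, _, _)); rewrite /=; ring.
Qed.

Lemma frobenius_identity_false p d (z : F) : z ^+ (p ^ d) = z -> z ^+ p != z ->
  ~ satisfies S (frobenius_identity p d).
Proof.
move=> zd zp.
(* Here [[x i, y0]] has corner entry [z ^+ i] and [[x i, y1]] has [z ^+ i.+1]. *)
pose v i : S := match i with
  | 0%N => pt (0, 1, 0) | 1%N => pt (0, z, 0) | i.+2 => pt (z ^+ i, 0, 0) end.
move=> /(_ v); have -> : eval v (frobenius_identity p d).1 = pt (0, 0, 0).
  rewrite /premises; apply/eval_sum_terms; split.
    apply/eval_Add; split; first exact: (@eval_quotient_self v y0 (0, 1, 0)).
    apply/eval_Add; split.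
      rewrite (@eval_commutator v y0 y1 (0, 1, 0) (0, z, 0)) //.
      by rewrite /heis_bracket /= !mul0r subrr.
    rewrite (@eval_quotient_commutator v _ _ _ _ (z ^+ (p ^ d), 0, 0) (0, 1, 0)
      (z ^+ 1, 0, 0) (0, 1, 0)) //.
    by rewrite /heis_bracket /= zd expr1 subrr.
  move=> i _.
  rewrite (@eval_quotient_commutator v _ _ _ _ (z ^+ i, 0, 0) (0, z, 0)
    (z ^+ i.+1, 0, 0) (0, 1, 0)) //.
  by rewrite /heis_bracket /= exprSr mulr1 !mul0r !subr0 subrr.
move=> /esym/eval_Add[_].
rewrite (@eval_quotient_commutator v _ _ _ _ (z ^+ p, 0, 0) (0, 1, 0)
      (z ^+ 1, 0, 0) (0, 1, 0)) //.
move=> /pt_inj[/eqP]; rewrite /heis_bracket /= expr1 !mulr1 !mul0r !subr0 subr_eq0.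
by rewrite (negPf zp).
Qed.

(** The bound [p <= p ^ d] makes [x p] occur in the premises; it is therefore a group element
    whenever their sum is one. *)
Lemma frobenius_identity_true p d : (0 < p <= p ^ d)%N ->
    (forall z : F, z ^+ (p ^ d) = z -> z ^+ p = z) ->
  satisfies S (frobenius_identity p d).
Proof.
move=> /andP[p0 pd] frob v.
have [E|[g E]] := ptP (eval v (premises p d)); first by rewrite [RHS]eval_AddN.
rewrite [LHS]E; apply/esym/eval_Add; split=> //; move: E.
move=> /eval_sum_terms[/eval_Add[q0 /eval_Add[q1 qN]] qi].
have [h0 [_ [v0 _]]] := eval_quotient_some q0.
have {q0}gE : g = (0, 0, 0) by move: q0; rewrite (eval_quotient_self v0) => /pt_inj.
have [_ [h1 [_ v1]]] := eval_commutator_some q1.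
have br : heis_bracket h0 h1 = 0.
  by move: q1; rewrite (eval_commutator v0 v1) gE => /pt_inj[].
pose h i := if v i.+2 is Some a then of_pt a else (0, 0, 0).
have hS i : (i < p ^ d)%N -> v i.+2 = pt (h i) /\ v i.+3 = pt (h i.+1).
  move=> /qi/eval_quotient_some[a [b [/eval_commutator_some[a' [_ [/= va _]]]]]].
  move=> /eval_commutator_some[b' [_ [/= vb _]]].
  by rewrite /h va vb !of_ptK.
have hv i : (i <= p ^ d)%N -> eval v (x i) = pt (h i).
  rewrite leq_eqVlt => /orP[/eqP->|/hS[]//].
  by have [|_] := hS (p ^ d).-1; rewrite prednK // (leq_trans p0).
pose c i := heis_bracket (h i) h0.
have N0 : (0 < p ^ d)%N by apply: leq_trans pd.
have cS i : (i < p ^ d)%N -> heis_bracket (h i) h1 = c i.+1.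
  move=> iN; move: (qi i iN).
  rewrite (eval_quotient_commutator (hv i (ltnW iN)) v1 (hv i.+1 iN) v0) gE.
  by move=> /pt_inj[/eqP]; rewrite subr_eq0 => /eqP.
have cN : c (p ^ d)%N = c 1%N.
  move: qN; rewrite (eval_quotient_commutator (hv _ (leqnn _)) v0 (hv 1%N N0) v0) gE.
  by move=> /pt_inj[/eqP]; rewrite subr_eq0 => /eqP.
rewrite (eval_quotient_commutator (hv p pd) v0 (hv 1%N N0) v0) gE; congr (pt (_, _, _)).
apply/eqP; rewrite subr_eq0 -/(c p) -/(c 1%N); apply/eqP.
case: h0 h1 br @c cS cN {v0 v1 q1 qN} => [[a0 b0] c0] [[a1 b1] c1] br c cS cN.
rewrite /heis_bracket /= in br.
(* If the first two coordinates of [y0] vanish, so do all brackets with it; otherwise [br] makes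
   those of [y1] their multiple by some [z]. *)
have [ab0|ab0] := boolP ((a0 == 0) && (b0 == 0)).
  case/andP: ab0 => /eqP a00 /eqP b00.
  by rewrite /c /heis_bracket /= a00 b00 !mulr0 !mul0r.
have [z az bz] : exists2 z, a1 = z * a0 & b1 = z * b0.
  have [a00|a00] := eqVneq a0 0.
    have b00 : b0 != 0 by move: ab0; rewrite a00 eqxx.
    exists (b1 / b0); rewrite ?divfK // a00 mulr0.
    move/eqP: br; rewrite a00 mul0r sub0r oppr_eq0 mulf_eq0 (negPf b00) orbF.
    by move/eqP.
  exists (a1 / a0); rewrite ?divfK //.
  apply: (mulfI a00); rewrite mulrA (mulrC a0 (a1 / a0)) divfK //.
  by apply/eqP; rewrite -subr_eq0 br.
have {}cS i : (i < p ^ d)%N -> c i.+1 = z * c i.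
  move=> /cS <-; rewrite /c /heis_bracket /= az bz; ring.
clearbody c.
have cE i : (i <= p ^ d)%N -> c i = z ^+ i * c 0%N.
  elim: i => [_|i IH iN]; first by rewrite mul1r.
  by rewrite cS // IH ?(ltnW iN) // mulrA exprS.
move: cN; rewrite (cE _ (leqnn _)) (cE _ pd) (cE _ N0) expr1.
have [->|c0N] := eqVneq (c 0%N) 0; first by rewrite !mulr0.
by move=> /(mulIf c0N)/frob ->.
Qed.

End Identities.

(** * Finite fields and the choice of the prime *)

Lemma card_field_expf_neq (F : finFieldType) p : (1 < p < #|F|)%N ->
  exists z : F, (z ^+ p != z)%R.
Proof.
move=> /andP[p1 pF]; apply/existsP; rewrite -[X in is_true X]negbK negb_exists.
apply/negP => /forallP zp.
have sP : size ('X^p - 'X : {poly F})%R = p.+1.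
  by rewrite size_polyDl ?size_polyXn // size_polyN size_polyX ltnS.
have P0 : ('X^p - 'X : {poly F})%R != 0%R by rewrite -size_poly_eq0 sP.
have zroot : all (root ('X^p - 'X : {poly F})%R) (enum F).
  apply/allP => z _; have := zp z; rewrite negbK => /eqP zE.
  by rewrite rootE !hornerE ?hornerXn zE subrr.
by have := max_poly_roots P0 zroot (enum_uniq F); rewrite sP -cardE ltnS leqNgt pF.
Qed.

(** By Bezout, some multiple of [e] is 1 plus a multiple of [d]. *)
Lemma frobenius_coprime (F : finFieldType) p d e (z : F) : coprime d e -> 0 < e ->
  (z ^+ (p ^ d) = z)%R -> (z ^+ (p ^ e) = z)%R -> (z ^+ p = z)%R.
Proof.
move=> /eqP de e0 zd ze.
have pow k f : (z ^+ (p ^ f) = z)%R -> (z ^+ (p ^ (k * f)) = z)%R.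
  by move=> zf; elim: k => [|k IH]; rewrite ?expr1 // mulSn expnD exprM zf.
have [a _ /dvdnP[b ab]] := Bezoutl d e0.
have := pow b e ze; rewrite -ab gcdnC de expnD exprM expn1.
by rewrite -exprM mulnC exprM pow.
Qed.

(** If 4 divides [m], take 2. Otherwise [m] has an odd prime factor, which divides ['C(m, 2)]
    because it divides [m * m.-1], twice that number. *)
Lemma exists_modulus m : (2 < m)%N -> exists p, [/\ prime p, p %| m & p %| 'C(m, 2)].
Proof.
move=> m2; have C2 : 'C(m, 2) * 2 = m * m.-1 by rewrite mulnC -mul_bin_diag bin1.
have [/dvdnP[k mE]|m4] := boolP (4 %| m).
  exists 2; split=> //; first by rewrite mE dvdn_mull.
  suff -> : 'C(m, 2) = 2 * (k * m.-1) by apply: dvdn_mulr.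
  apply/eqP; rewrite -(eqn_pmul2r (m := 2)) // C2 {1}mE mulnAC.
  by apply/eqP; rewrite [2 * _]mulnC -[RHS]mulnA.
have [k [kodd k1 km]] : exists k, [/\ odd k, 1 < k & k %| m].
  have [mo|me] := boolP (odd m); first by exists m; rewrite mo dvdnn (ltnW m2).
  have mE : m = m./2 * 2 by rewrite muln2 -{1}(odd_double_half m) (negPf me).
  exists m./2; split; last by rewrite {2}mE dvdn_mulr.
  - apply: contraR m4 => ke; rewrite mE (_ : 4 = 2 * 2) // dvdn_pmul2r //.
    by rewrite dvdn2.
  - by move: m2; rewrite mE; case: (m./2) => [|[|]].
exists (pdiv k); have pk := pdiv_prime k1; have pdk := pdiv_dvd k.
have pm := dvdn_trans pdk km; split=> //.
rewrite -(@Gauss_dvdl _ _ 2) ?C2 ?dvdn_mulr // coprimen2.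
exact: dvdn_odd pdk kodd.
Qed.

Lemma frobenius_identity_spec m p (F : finFieldType) d e : (1 < m)%N -> prime p ->
    p \in [pchar F]%R -> p %| m -> p %| 'C(m, 2) -> prime d -> prime e -> #|F| = p ^ d ->
  satisfies (flat_heis F) (frobenius_identity m p e) <-> d <> e.
Proof.
move=> m1 pp pF pm pC pd pe cF.
have m0 : (m%:R = 0 :> F)%R by apply/eqP; rewrite -(dvdn_pcharf pF).
have C0 : ('C(m, 2)%:R = 0 :> F)%R by apply/eqP; rewrite -(dvdn_pcharf pF).
have zF (z : F) : (z ^+ (p ^ d) = z)%R by rewrite -cF expf_card.
have p1 := prime_gt1 pp; have d1 := prime_gt1 pd; have e1 := prime_gt1 pe.
split=> [hS de|de].
  have [|z zp] := @card_field_expf_neq F p.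
    by rewrite p1 cF -{1}(expn1 p) ltn_exp2l.
  by apply: (frobenius_identity_false m1 m0 C0 _ zp) hS; rewrite -de.
apply: frobenius_identity_true => //.
  by rewrite (ltnW p1) -{1}(expn1 p) leq_exp2l // ltnW.
move=> z ze; apply: (frobenius_coprime _ _ (zF z) ze); last exact: ltnW.
by rewrite prime_coprime // dvdn_prime2 //; apply/eqP.
Qed.

(** * Uncountably many subvarieties, and the conclusion *)

Local Open Scope classical_set_scope.

Lemma uncountable_subvarieties n : (3 < n)%N -> ~ countable (subvarieties (Sr n)).
Proof.
case: n => // m m2 /countable_injP[f finj].
have [p [pp pm pC]] := exists_modulus m2.
have /choice[nthp nthpP] : forall n, exists q, prime q /\ (n < q)%N.
  by move=> n; have [q nq pq] := prime_above n; exists q.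
pose q := fix q i := if i is i'.+1 then nthp (q i') else nthp 0.
have pq i : prime (q i) by case: i => [|i]; [case: (nthpP 0) | case: (nthpP (q i))].
have qinj : injective q.
  apply: incn_inj; apply: leq_mono; apply: homo_ltn; first exact: ltn_trans.
  by move=> i; case: (nthpP (q i)).
(* The identities indexed outside [A] are imposed, so the extension over the field of order
   [p ^ q i] lies in [K A] exactly for [i] in [A]. *)
pose K (A : set nat) := models [set e | e = (iterop m.+1 Mul (Var 0) (Var 0), Var 0) \/
  exists i, ~ A i /\ e = frobenius_identity m p (q i)].
have KV A : subvarieties (Sr m.+1) (K A).
  split; first by eexists.
  by move=> S KS e ->; apply: KS; left.
have Kinj A B : K A = K B -> A `<=` B.
  move=> KAB i Ai; apply: contrapT => nBi.
  have [F pF cF] := pPrimePowerField pp (prime_gt0 (pq i)).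
  have spec := frobenius_identity_spec (ltnW m2) pp pF pm pC (pq i) (pq _) cF.
  suff : K A (flat_heis F).
    rewrite KAB => /(_ (frobenius_identity m p (q i))) h.
    by apply: (spec i).1 => //; apply: h; right; exists i.
  move=> e [->|[j [nAj ->]]].
    have m0 : (m%:R = 0 :> F)%R by apply/eqP; rewrite -(dvdn_pcharf pF).
    have C0 : ('C(m, 2)%:R = 0 :> F)%R by apply/eqP; rewrite -(dvdn_pcharf pF).
    exact: (flat_sr m0 C0 erefl).
  by apply/(spec j) => /qinj ij; apply: nAj; rewrite -ij.
have fKinj A B : f (K A) = f (K B) -> A = B.
  move=> /finj; rewrite !inE => /(_ (KV A) (KV B)) KAB.
  by apply/seteqP; split; apply: Kinj.
(* Cantor's diagonal set for the injection of the sets of naturals into [nat] that sends [A] to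
   [f (K A)]. *)
pose D := [set i | exists A, f (K A) = i /\ ~ A i].
have [DD|nDD] := EM (D (f (K D))).
  by have [A [/fKinj -> ]] := DD.
by apply: (nDD); exists D.
Qed.

Theorem theorem3p5 (n : nat) (hn : (1 < n)%N) :
  countable (subvarieties (Sr n)) <-> (n < 4)%N.
Proof.
split=> [cn|n4]; first by rewrite ltnNge; apply/negP => /uncountable_subvarieties.
(* Both [x^2 = x] and [x^3 = x] give the cube law, read off at the constant valuation [a]. *)
apply: countable_subvarieties => S a /(_ _ erefl (fun=> a)).
by case: n hn n4 => [|[|[|[|]]]] //= _ _ aE; rewrite ?aE.
Qed.
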